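(* Let $k\in\mathbb C$ with $\Re(k)<0$, and let $f:\mathbb Q\to\mathbb C$ be $1$-periodic (i.e. $f(x+1)=f(x)$ for all $x\in\mathbb Q$). Let $h:\mathbb R\setminus\{0\}\to\mathbb C$ be such that $$h(x)=f(x)-|x|^{-k}f(-1/x)\qquad (x\in\mathbb Q\setminus\{0\}),$$ and assume that $h$ is continuous on $[-1,1]\setminus\{0\}$ with finite left and right limits $h(0^-)$, $h(0^+)$ at $0$. Then the function $$f^\dagger(x):=\begin{cases} f(x) & x\in\mathbb Q,\\ \lim_{\mathbb Q\ni y\to x} f(y) & x\notin\mathbb Q\end{cases}$$ is well defined for all $x\in\mathbb R$ (i.e. the limit exists for every irrational $x$) and is continuous on $\mathbb R\setminus\mathbb Q$. Moreover, for any rational $x=a/q$ in reduced form ($q\geq 1$), one has $f^\dagger(y)\to f(x)+q^k(h(0^+)-f(0))$ as $y\to x^+$ and $f^\dagger(y)\to f(x)+q^k(h(0^-)-f(0))$ as $y\to x^-$. In particular, $f^\dagger$ is continuous on $\mathbb R$ if and only if $h(0^+)=h(0^-)=f(0)$. Furthermore, in this case (i.e. when $h(0^\pm)=f(0)$), if $h\in\mathcal C^m([-1,1],\mathbb C)$ for an integer $m$ with $0\leq m<|\Re(k)|/2$, then $f^\dagger\in\mathcal C^m(\mathbb R,\mathbb C)$.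
   Context: For $z\in\mathbb C$ and $t>0$, $t^{z}=e^{z\log t}$. In the last sentence, $h\in\mathcal C^m([-1,1])$ means that $h$ (extended at $0$ by its common one-sided limit) is $m$ times continuously differentiable on $[-1,1]$. *)

(* Defs.v *)
From Stdlib Require Export Reals QArith Qcanon ClassicalEpsilon.
From Coquelicot Require Export Coquelicot.

Definition cexp (z : C) : C :=
  (exp (Re z) * cos (Im z), exp (Re z) * sin (Im z))%R.

Definition cpow (t : R) (z : C) : C := cexp (z * RtoC (ln t))%C.

Definition QcR (q : Qc) : R := Q2R (this q).

Definition is_rational (x : R) : Prop := exists q : Qc, QcR q = x.

Definition rat_lim (f : Qc -> C) (x : R) (L : C) : Prop :=
  forall eps : R, (0 < eps)%R -> exists delta : R, (0 < delta)%R /\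
    forall y : Qc, QcR y <> x -> (Rabs (QcR y - x) < delta)%R ->
      (Cmod (f y - L) < eps)%R.

(* f^dagger: f on rationals, limit along rationals at irrationals
   (an arbitrary value if that limit does not exist). *)
Definition fdag (f : Qc -> C) (x : R) : C :=
  epsilon (inhabits (RtoC 0)) (fun v =>
    (exists q : Qc, QcR q = x /\ v = f q) \/
    (~ is_rational x /\ rat_lim f x v)).

(* g is m times continuously differentiable on the set D (derivatives and
   continuity taken within D, i.e. one-sided at boundary points). *)
Definition Cm_on (D : R -> Prop) (m : nat) (g : R -> C) : Prop :=
  exists G : nat -> R -> C,
    (forall x, D x -> G O x = g x) /\
    (forall j x, (j < m)%nat -> D x ->
       filterlim (fun y => ((G j y - G j x) / RtoC (y - x))%C)
         (within (fun y => D y /\ y <> x) (locally x)) (locally (G (S j) x))) /\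
    (forall j x, (j <= m)%nat -> D x ->
       filterlim (G j) (within D (locally x)) (locally (G j x))).

Definition Icc11 (x : R) : Prop := (-1 <= x <= 1)%R.

(* Main.v *)
(** Write [p = -k], [F = fdag f]. For [0 < |x| < 1] one has [F x = h x + |x|^p F(-1/x)].
    Translating into [-1/2, 1/2] and then applying [x |-> -1/x] multiplies the oscillation
    of [F] (along the rationals) by at most [2^(-Re p) < 1], because the continuity of [h] and
    of [|x|^p] and the boundedness of [F] make the other terms negligible; hence the
    oscillation vanishes at every irrational. At [0] the term [|x|^p F(-1/x)] tends to [0],
    and the equation carries the one-sided limits from [-1/x] to [x], that is, along the
    nearest-integer Euclidean algorithm. For smoothness the same oscillation argument is run
    on the difference quotients of [F], which contract by [2^(-(Re p - 2))]; then [F'] solves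
    an equation of the same kind with [p - 2] for [p], and one inducts on [m]. *)
Require Import Defs.
From Stdlib Require Import Lra Lia ZArith Qreals Classical.
Open Scope R_scope.

(** * Limits *)

(** The contraction can only improve a bound that already holds everywhere, so each oscillation
    argument needs an a priori estimate: boundedness of [F] along the rationals in one case, a
    global Lipschitz constant in the other. The Lipschitz constant does not come from the
    contraction at single points; it is obtained from pairs of points, whose distance grows under
    [x |-> -1/x]. A second obstacle is the point [0]: there [-1/x] is singular and [F (- / x)] need
    not have a limit, so [0] is treated directly, through the smallness of [|x|^p]. Slopes are
    measured between two points that both move: the resulting strict derivative, once it exists
    everywhere, is automatically continuous, which is exactly what the induction requires of [F'].
    The exponent drops by 2 because [-1/x] has derivative [x^(-2)]; after [m] such losses it must
    still be positive, whence [m < |Re k| / 2]. *)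

Definition lim_on (D : R -> Prop) (g : R -> C) (x : R) (l : C) : Prop :=
  forall eps, 0 < eps -> exists delta, 0 < delta /\
    forall y, D y -> Rabs (y - x) < delta -> Cmod (g y - l) < eps.

Definition near (x : R) (P : R -> Prop) : Prop :=
  exists delta, 0 < delta /\ forall y, Rabs (y - x) < delta -> P y.

Lemma near_and x P Q : near x P -> near x Q -> near x (fun y => P y /\ Q y).
Proof.
  intros (d1 & H1 & K1) (d2 & H2 & K2).
  exists (Rmin d1 d2); split; [now apply Rmin_pos|].
  intros y Hy.
  pose proof (Rmin_l d1 d2); pose proof (Rmin_r d1 d2).
  split; [apply K1|apply K2]; lra.
Qed.

Lemma near_impl x (P Q : R -> Prop) :
  (forall y, P y -> Q y) -> near x P -> near x Q.
Proof. intros H (d & Hd & K); exists d; split; auto. Qed.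

Lemma near_lt x a b : a < x < b -> near x (fun y => a < y < b).
Proof.
  intros H; exists (Rmin (x - a) (b - x)); split; [apply Rmin_pos; lra|].
  intros y Hy.
  pose proof (Rmin_l (x - a) (b - x)); pose proof (Rmin_r (x - a) (b - x)).
  unfold Rabs in Hy; destruct (Rcase_abs (y - x)); lra.
Qed.

Lemma near_neq0 x : x <> 0 -> near x (fun y => 0 < x * y).
Proof.
  intros H; destruct (Rtotal_order x 0) as [K|[K|K]]; [|lra|].
  - apply (near_impl x (fun y => x - 1 < y < 0)); [|apply near_lt; lra].
    intros; nra.
  - apply (near_impl x (fun y => 0 < y < x + 1)); [|apply near_lt; lra].
    intros; nra.
Qed.

Lemma Cmod_minus_sym (a b : C) : Cmod (a - b) = Cmod (b - a).
Proof. rewrite <- Cmod_opp; f_equal; ring. Qed.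

Lemma Cmod_triangle3 (a b c : C) : Cmod (a - c) <= Cmod (a - b) + Cmod (b - c).
Proof. replace (a - c)%C with ((a - b) + (b - c))%C by ring; apply Cmod_triangle. Qed.

Lemma Cmod_small_eq (a b : C) : (forall eps, 0 < eps -> Cmod (a - b) < eps) -> a = b.
Proof.
  intros H.
  assert (K : (a - b)%C = 0%C).
  { apply Cmod_eq_0; pose proof (Cmod_ge_0 (a - b)).
    destruct (Rle_lt_dec (Cmod (a - b)) 0) as [L|L]; [lra|].
    specialize (H _ L); lra. }
  replace a with ((a - b) + b)%C by ring; rewrite K; ring.
Qed.

(** The topology of [C] is that of a product, with square balls; squares and modulus discs compare
    up to the factor [sqrt 2]. *)
Lemma locally_Cmod (l : C) (P : C -> Prop) :
  locally l P <-> exists eps, 0 < eps /\ forall z, Cmod (z - l) < eps -> P z.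
Proof.
  split.
  - intros [e He]; exists e; split; [apply cond_pos|].
    intros z Hz; apply He; exact (C_NormedModule_mixin_compat1 l z e Hz).
  - intros (e & He & K).
    assert (Hs : 0 < sqrt 2) by (apply sqrt_lt_R0; lra).
    assert (He' : 0 < e / sqrt 2) by (apply Rdiv_lt_0_compat; lra).
    exists (mkposreal _ He'); intros z Hz; apply K.
    apply Rlt_le_trans with (1 := C_NormedModule_mixin_compat2 l z _ Hz).
    simpl; right; field; lra.
Qed.

Lemma filterlim_lim_on (D : R -> Prop) (g : R -> C) (x : R) (l : C) :
  filterlim g (within D (locally x)) (locally l) <-> lim_on D g x l.
Proof.
  split.
  - intros H e He.
    destruct (H (fun z => Cmod (z - l) < e)) as [d Hd].
    { apply locally_Cmod; exists e; auto. }
    exists d; split; [apply cond_pos|]; intros y Dy Hy; now apply Hd.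
  - intros H P HP; apply locally_Cmod in HP; destruct HP as (e & He & K).
    destruct (H e He) as (d & Hd & Kd).
    exists (mkposreal d Hd); intros y Hy Dy; apply K, Kd; auto.
Qed.

Lemma continuous_lim_on (g : R -> C) (x : R) :
  continuous g x <-> lim_on (fun _ => True) g x (g x).
Proof.
  rewrite <- filterlim_lim_on; unfold continuous; split; intros H P HP.
  - destruct (H P HP) as [d Hd]; exists d; intros y Hy _; now apply Hd.
  - destruct (H P HP) as [d Hd]; exists d; intros y Hy; now apply Hd.
Qed.

(** The comparison is made only near [x] and only on [D2], so one lemma covers both restriction to a
    subset and replacement of [F] by the right side of its functional equation. *)
Lemma lim_on_near (D1 D2 : R -> Prop) g1 g2 x l :
  near x (fun y => D2 y -> D1 y /\ g1 y = g2 y) ->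
  lim_on D1 g1 x l -> lim_on D2 g2 x l.
Proof.
  intros (d1 & H1 & K1) H e He; destruct (H e He) as (d2 & H2 & K2).
  exists (Rmin d1 d2); split; [now apply Rmin_pos|]; intros y Dy Hy.
  pose proof (Rmin_l d1 d2); pose proof (Rmin_r d1 d2).
  destruct (K1 y) as [A B]; [lra|auto|].
  rewrite <- B; apply K2; [auto|lra].
Qed.

Lemma lim_on_sub (D1 D2 : R -> Prop) g x l :
  (forall y, D2 y -> D1 y) -> lim_on D1 g x l -> lim_on D2 g x l.
Proof. intros H; apply lim_on_near; exists 1; split; [lra|]; auto. Qed.

Lemma lim_on_const D c x : lim_on D (fun _ => c) x c.
Proof.
  intros e He; exists 1; split; [lra|]; intros.
  replace (c - c)%C with (RtoC 0) by ring; now rewrite Cmod_0.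
Qed.

Lemma lim_on_plus D g1 g2 x l1 l2 :
  lim_on D g1 x l1 -> lim_on D g2 x l2 ->
  lim_on D (fun y => g1 y + g2 y)%C x (l1 + l2)%C.
Proof.
  intros A B e He.
  destruct (A (e / 2)) as (d1 & H1 & K1); [lra|].
  destruct (B (e / 2)) as (d2 & H2 & K2); [lra|].
  exists (Rmin d1 d2); split; [now apply Rmin_pos|]; intros y Dy Hy.
  pose proof (Rmin_l d1 d2); pose proof (Rmin_r d1 d2).
  replace (g1 y + g2 y - (l1 + l2))%C with ((g1 y - l1) + (g2 y - l2))%C by ring.
  eapply Rle_lt_trans; [apply Cmod_triangle|].
  specialize (K1 y Dy); specialize (K2 y Dy); lra.
Qed.

(** Made for the point [0]: the factor [F (- / y)] need not converge there, and only its boundedness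
    is available. *)
Lemma lim_on_null_mult_bounded D g1 g2 x M :
  lim_on D g1 x 0%C ->
  near x (fun y => D y -> Cmod (g2 y) <= M) ->
  lim_on D (fun y => g1 y * g2 y)%C x 0%C.
Proof.
  intros A (d2 & H2 & K2) e He.
  set (M' := Rabs M + 1).
  assert (HM' : 0 < M') by (unfold M'; pose proof (Rabs_pos M); lra).
  destruct (A (e / M')) as (d1 & H1 & K1); [now apply Rdiv_lt_0_compat|].
  exists (Rmin d1 d2); split; [now apply Rmin_pos|]; intros y Dy Hy.
  pose proof (Rmin_l d1 d2); pose proof (Rmin_r d1 d2).
  specialize (K1 y Dy); specialize (K2 y).
  replace (g1 y - 0)%C with (g1 y) in K1 by ring.
  replace (g1 y * g2 y - 0)%C with (g1 y * g2 y)%C by ring.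
  rewrite Cmod_mult.
  assert (Cmod (g2 y) <= M') by (unfold M'; pose proof (Rle_abs M);
        assert (Cmod (g2 y) <= M) by (apply K2; auto; lra); lra).
  assert (Cmod (g1 y) < e / M') by (apply K1; lra).
  apply Rle_lt_trans with (Cmod (g1 y) * M').
  - apply Rmult_le_compat_l; [apply Cmod_ge_0|auto].
  - apply Rlt_le_trans with (e / M' * M'); [now apply Rmult_lt_compat_r|].
    right; field; lra.
Qed.

Lemma lim_on_minus D g x l : lim_on D g x l <-> lim_on D (fun y => g y - l)%C x 0%C.
Proof.
  split; intros H e He; destruct (H e He) as (d & Hd & K); exists d; split; auto;
    intros y Dy Hy; specialize (K y Dy Hy);
    replace (g y - l - 0)%C with (g y - l)%C in * by ring; auto.
Qed.

Lemma lim_on_bounded D g x l :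
  lim_on D g x l -> near x (fun y => D y -> Cmod (g y) <= Cmod l + 1).
Proof.
  intros H; destruct (H 1) as (d & Hd & K); [lra|].
  exists d; split; auto; intros y Hy Dy; specialize (K y Dy Hy).
  replace (g y) with ((g y - l) + l)%C by ring.
  eapply Rle_trans; [apply Cmod_triangle|lra].
Qed.

Lemma lim_on_mult D g1 g2 x l1 l2 :
  lim_on D g1 x l1 -> lim_on D g2 x l2 ->
  lim_on D (fun y => g1 y * g2 y)%C x (l1 * l2)%C.
Proof.
  intros A B; apply lim_on_minus.
  assert (A' := A); apply -> lim_on_minus in A'.
  assert (B' := B); apply -> lim_on_minus in B'.
  apply lim_on_near with (D1 := D)
    (g1 := (fun y => (g1 y - l1) * g2 y + (g2 y - l2) * l1)%C).
  { exists 1; split; [lra|]; intros; split; [auto|ring]. }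
  replace (RtoC 0) with (0 + 0)%C by ring.
  apply lim_on_plus.
  - eapply lim_on_null_mult_bounded; [exact A'|apply lim_on_bounded; exact B].
  - apply (lim_on_null_mult_bounded _ _ _ _ (Cmod l1)); auto.
    exists 1; split; [lra|]; intros; lra.
Qed.

Lemma lim_on_comp (D D' : R -> Prop) g (phi : R -> R) x x' l :
  lim_on D' g x' l ->
  continuity_pt phi x -> phi x = x' ->
  near x (fun y => D y -> D' (phi y)) ->
  lim_on D (fun y => g (phi y)) x l.
Proof.
  intros H Hc Hx (d2 & H2 & K2) e He; destruct (H e He) as (d & Hd & K).
  destruct (proj1 (continuity_pt_locally phi x) Hc (mkposreal d Hd)) as [d1 H1].
  exists (Rmin d1 d2); split; [apply Rmin_pos; auto; apply cond_pos|].
  intros y Dy Hy.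
  pose proof (Rmin_l d1 d2); pose proof (Rmin_r d1 d2).
  apply K; [apply K2; auto; lra|].
  subst x'; apply H1; change (Rabs (y - x) < d1); lra.
Qed.

Lemma lim_on_unique (D : R -> Prop) g x l1 l2 :
  (forall delta, 0 < delta -> exists y, D y /\ Rabs (y - x) < delta) ->
  lim_on D g x l1 -> lim_on D g x l2 -> l1 = l2.
Proof.
  intros HD A B; apply Cmod_small_eq; intros e He.
  destruct (A (e / 2)) as (d1 & H1 & K1); [lra|].
  destruct (B (e / 2)) as (d2 & H2 & K2); [lra|].
  destruct (HD (Rmin d1 d2)) as (y & Dy & Hy); [now apply Rmin_pos|].
  pose proof (Rmin_l d1 d2); pose proof (Rmin_r d1 d2).
  specialize (K1 y Dy); specialize (K2 y Dy).
  apply Rle_lt_trans with (1 := Cmod_triangle3 l1 (g y) l2).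
  rewrite (Cmod_minus_sym l1); lra.
Qed.

Lemma Cmod_Re_Im (z : C) : Cmod z <= Rabs (Re z) + Rabs (Im z).
Proof.
  replace z with (RtoC (Re z) + Ci * RtoC (Im z))%C at 1.
  2: { destruct z; apply injective_projections; simpl; ring. }
  eapply Rle_trans; [apply Cmod_triangle|].
  rewrite Cmod_mult, !Cmod_R.
  assert (Cmod Ci = 1) as ->; [|lra].
  unfold Cmod, Ci; simpl; transitivity (sqrt 1); [f_equal; ring|apply sqrt_1].
Qed.

(* The limit is read off componentwise: [Re L] is the least upper bound of the
   numbers [Re l - eps] over all admissible approximations. *)
Lemma approx_complete (A : C -> R -> Prop) :
  (forall eps, 0 < eps -> exists l, A l eps) ->
  (forall l e l' e', A l e -> A l' e' -> Cmod (l - l') <= e + e') ->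
  exists L, forall l e, A l e -> Cmod (l - L) <= 2 * e.
Proof.
  intros Hex Hc.
  assert (comp : forall p : C -> R,
            (forall u v, Rabs (p u - p v) <= Cmod (u - v)) ->
            exists a, forall l e, A l e -> Rabs (p l - a) <= e).
  { intros p Hp.
    assert (Hle : forall l e l' e', A l e -> A l' e' -> p l - e <= p l' + e').
    { intros l e l' e' H H'; specialize (Hc _ _ _ _ H H'); specialize (Hp l l').
      pose proof (Rle_abs (p l - p l')); lra. }
    destruct (completeness (fun r => exists l e, A l e /\ r = p l - e)) as [a [Ha1 Ha2]].
    - destruct (Hex 1) as [l Hl]; [lra|].
      exists (p l + 1); intros r (l' & e & H & ->); eapply Hle; eauto.
    - destruct (Hex 1) as [l Hl]; [lra|]; exists (p l - 1); eauto.
    - exists a; intros l e H; apply Rabs_le; split.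
      + assert (a <= p l + e); [|lra].
        apply Ha2; intros r (l' & e' & H' & ->); eapply Hle; eauto.
      + assert (p l - e <= a); [|lra].
        apply Ha1; exists l, e; auto. }
  destruct (comp Re) as [a Ha].
  { intros u v; pose proof (re_le_Cmod (u - v)); exact H. }
  destruct (comp Im) as [b Hb].
  { intros u v; pose proof (Rmax_Cmod (u - v)%C) as H.
    eapply Rle_trans; [|exact H]; exact (Rmax_r (Rabs (fst (u - v)%C)) _). }
  (* Each coordinate is off by at most [e]; adding the two gives the factor 2. *)
  exists (a, b); intros l e H.
  eapply Rle_trans; [apply Cmod_Re_Im|].
  specialize (Ha l e H); specialize (Hb l e H).
  unfold Re, Im in *; simpl; unfold Rminus in *; lra.
Qed.

(** * Complex powers and rationals *)

Lemma cexp_plus (z w : C) : cexp (z + w) = (cexp z * cexp w)%C.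
Proof.
  unfold cexp; destruct z as [a b], w as [c d]; simpl.
  apply injective_projections; simpl;
    rewrite exp_plus, ?cos_plus, ?sin_plus; ring.
Qed.

Lemma Cmod_cexp (z : C) : Cmod (cexp z) = exp (Re z).
Proof.
  unfold cexp, Cmod; destruct z as [a b]; simpl.
  pose proof (sin2_cos2 b) as H; unfold Rsqr in H.
  transitivity (sqrt (exp a * exp a)).
  - f_equal; nra.
  - apply sqrt_square; left; apply exp_pos.
Qed.

Lemma cpow_plus t z w : cpow t (z + w) = (cpow t z * cpow t w)%C.
Proof. unfold cpow; rewrite <- cexp_plus; f_equal; ring. Qed.

Lemma cpow_mult_base t u z : 0 < t -> 0 < u -> cpow (t * u) z = (cpow t z * cpow u z)%C.
Proof.
  intros Ht Hu; unfold cpow; rewrite <- cexp_plus, ln_mult by auto.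
  f_equal; rewrite RtoC_plus; ring.
Qed.

Lemma cpow_0_r t : cpow t 0 = 1%C.
Proof.
  unfold cpow; replace (0 * RtoC (ln t))%C with (RtoC 0) by ring.
  unfold cexp; simpl; rewrite exp_0, cos_0, sin_0; apply injective_projections; simpl; ring.
Qed.

Lemma cpow_1_l z : cpow 1 z = 1%C.
Proof.
  unfold cpow; rewrite ln_1; replace (z * 0)%C with (RtoC 0) by ring.
  unfold cexp; simpl; rewrite exp_0, cos_0, sin_0; apply injective_projections; simpl; ring.
Qed.

Lemma cpow_1_r t : 0 < t -> cpow t 1 = RtoC t.
Proof.
  intros Ht; unfold cpow; replace (1 * RtoC (ln t))%C with (RtoC (ln t)) by ring.
  unfold cexp; simpl; rewrite exp_ln, cos_0, sin_0 by auto.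
  apply injective_projections; simpl; ring.
Qed.

Lemma cpow_opp_cancel t z : (cpow t (- z) * cpow t z = 1)%C.
Proof.
  rewrite <- cpow_plus; replace (- z + z)%C with (RtoC 0) by ring; apply cpow_0_r.
Qed.

Lemma Cmod_cpow t z : Cmod (cpow t z) = Rpower t (Re z).
Proof.
  unfold cpow; rewrite Cmod_cexp; unfold Rpower; f_equal.
  destruct z; simpl; ring.
Qed.

Lemma cpow_minus_2 x z :
  x <> 0 -> cpow (Rabs x) (z - 2) = (cpow (Rabs x) z / RtoC (x * x))%C.
Proof.
  intros Hx; pose proof (Rabs_pos_lt x Hx) as Hp.
  assert (Hxx : RtoC (x * x) <> 0%C) by (intros E; apply RtoC_inj in E; nra).
  replace z with ((z - 2) + 1 + 1)%C at 2 by ring.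
  rewrite !cpow_plus, cpow_1_r by auto.
  assert (E : RtoC (x * x) = (RtoC (Rabs x) * RtoC (Rabs x))%C).
  { rewrite <- RtoC_mult; f_equal; unfold Rabs; destruct (Rcase_abs x); ring. }
  rewrite E in *; field; intros E0; apply Hxx; rewrite E0; ring.
Qed.

Lemma Rpower_le_base t u s : 0 < t <= u -> 0 <= s -> Rpower t s <= Rpower u s.
Proof. intros; apply Rle_Rpower_l; auto. Qed.

Lemma Rpower_lt_1 t s : 0 < t < 1 -> 0 < s -> Rpower t s < 1.
Proof.
  intros [H1 H2] Hs; unfold Rpower; rewrite <- exp_0; apply exp_increasing.
  pose proof (ln_increasing t 1 H1 H2); rewrite ln_1 in *; nra.
Qed.

Lemma Rpower_pos t s : 0 < Rpower t s.
Proof. apply exp_pos. Qed.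

Lemma QcR_Q2Qc q : QcR (Q2Qc q) = Q2R q.
Proof. apply Qeq_eqR; simpl; apply Qred_correct. Qed.

Lemma QcR_inj p q : QcR p = QcR q -> p = q.
Proof. intros H; apply Qc_is_canon, eqR_Qeq, H. Qed.

Lemma QcR_plus_1 q : QcR (q + 1)%Qc = QcR q + 1.
Proof.
  unfold Qcplus; rewrite QcR_Q2Qc, Q2R_plus; unfold QcR; f_equal.
  simpl; unfold Q2R; simpl; field.
Qed.

Lemma QcR_0 : QcR 0%Qc = 0.
Proof. unfold QcR, Q2R; simpl; field. Qed.

Lemma QcR_neq_0 q : q <> 0%Qc -> QcR q <> 0.
Proof. intros H E; apply H, QcR_inj; now rewrite QcR_0. Qed.

Lemma QcR_opp_inv q : q <> 0%Qc -> QcR (- / q)%Qc = - / QcR q.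
Proof.
  intros H; unfold Qcopp; rewrite QcR_Q2Qc, Q2R_opp; f_equal.
  change (QcR (/ q)%Qc = / QcR q).
  unfold Qcinv; rewrite QcR_Q2Qc, Q2R_inv; [reflexivity|].
  intros E; apply (QcR_neq_0 q H); unfold QcR; rewrite (Qeq_eqR _ _ E); unfold Q2R; simpl; field.
Qed.

Lemma is_rational_frac a b : (0 < b)%Z -> is_rational (IZR a / IZR b).
Proof.
  intros Hb; exists (Q2Qc (Qmake a (Z.to_pos b))).
  rewrite QcR_Q2Qc; unfold Q2R; simpl; rewrite Z2Pos.id by auto; reflexivity.
Qed.

Lemma QcR_frac q :
  QcR q = IZR (Qnum (this q)) / IZR (Z.pos (Qden (this q))) /\
  Z.gcd (Qnum (this q)) (Z.pos (Qden (this q))) = 1%Z.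
Proof. split; [reflexivity|]; apply Qred_iff, canon. Qed.

Lemma is_rational_coprime x :
  is_rational x ->
  exists a b, (0 < b)%Z /\ Z.gcd a b = 1%Z /\ x = IZR a / IZR b.
Proof.
  intros [q <-]; destruct (QcR_frac q) as [E G].
  exists (Qnum (this q)), (Z.pos (Qden (this q))); repeat split; auto.
Qed.

Lemma is_rational_plus_IZR x n : is_rational x -> is_rational (x + IZR n).
Proof.
  intros H; destruct (is_rational_coprime x H) as (a & b & Hb & _ & ->).
  assert (0 < IZR b) by (apply (IZR_lt 0); auto).
  replace (IZR a / IZR b + IZR n) with (IZR (a + n * b) / IZR b).
  - now apply is_rational_frac.
  - rewrite plus_IZR, mult_IZR; field; lra.
Qed.

Lemma is_rational_opp_inv x : is_rational x -> is_rational (- / x).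
Proof.
  intros [q Hq]; destruct (Req_dec x 0) as [->|Hx].
  - exists 0%Qc; rewrite Rinv_0, QcR_0; ring.
  - exists (- / q)%Qc; rewrite QcR_opp_inv, Hq; [reflexivity|].
    intros ->; apply Hx; rewrite <- Hq; apply QcR_0.
Qed.

Lemma opp_inv_involutive x : - / (- / x) = x.
Proof. rewrite Rinv_opp, Rinv_inv; ring. Qed.

Lemma irrational_plus_IZR x n : ~ is_rational x -> ~ is_rational (x + IZR n).
Proof.
  intros H K; apply H.
  replace x with ((x + IZR n) + IZR (- n)) by (rewrite opp_IZR; ring).
  now apply is_rational_plus_IZR.
Qed.

Lemma irrational_opp_inv x : ~ is_rational x -> ~ is_rational (- / x).
Proof.
  intros H K; apply H; rewrite <- (opp_inv_involutive x).
  now apply is_rational_opp_inv.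
Qed.

Lemma irrational_neq_0 x : ~ is_rational x -> x <> 0.
Proof. intros H ->; apply H; exists 0%Qc; apply QcR_0. Qed.

Lemma rational_dense_right x d : 0 < d -> exists y, is_rational y /\ x < y < x + d.
Proof.
  intros Hd; destruct (archimed (/ d)) as [A _]; set (b := up (/ d)) in *.
  pose proof (Rinv_0_lt_compat d Hd).
  assert (Hb : 0 < IZR b) by lra.
  destruct (archimed (x * IZR b)) as [B1 B2]; set (a := up (x * IZR b)) in *.
  exists (IZR a / IZR b); split.
  - apply is_rational_frac, lt_IZR; auto.
  - assert (E : IZR a / IZR b * IZR b = IZR a) by (field; lra).
    assert (1 < d * IZR b).
    { apply Rmult_lt_reg_l with (/ d); auto; rewrite <- Rmult_assoc, Rinv_l by lra; lra. }
    split; apply Rmult_lt_reg_r with (IZR b); auto; rewrite E; lra.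
Qed.

Lemma nearest_int x : exists n, Rabs (x + IZR n) <= 1 / 2.
Proof.
  destruct (archimed (x - 1 / 2)) as [A B]; set (a := up (x - 1 / 2)) in *.
  exists (- a)%Z; rewrite opp_IZR; apply Rabs_le; lra.
Qed.

(** The nearest-integer Euclidean algorithm as an induction principle: translation brings the
    numerator down to at most half the denominator, and [x |-> -1/x] then exchanges the two, so
    denominators decrease until [0/1] is reached. The factor [Z.sgn a] keeps denominators
    positive. *)
Lemma coprime_ind (P : Z -> Z -> Prop) :
  P 0%Z 1%Z ->
  (forall a b n, (0 < b)%Z -> P a b -> P (a + n * b)%Z b) ->
  (forall a b, (0 < b)%Z -> a <> 0%Z -> (2 * Z.abs a <= b)%Z ->
     P (- (b * Z.sgn a))%Z (Z.abs a) -> P a b) ->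
  forall a b, (0 < b)%Z -> Z.gcd a b = 1%Z -> P a b.
Proof.
  intros H0 HT HI.
  assert (K : forall n : nat, forall a b, (0 < b)%Z -> (b <= Z.of_nat n)%Z ->
                Z.gcd a b = 1%Z -> P a b).
  { induction n as [|n IH]; intros a b Hb Hn G; [lia|].
    (* The floor of [a/b + 1/2], that is, the integer nearest to [a/b]. *)
    set (c := ((2 * a + b) / (2 * b))%Z).
    assert (Hc : (2 * Z.abs (a - c * b) <= b)%Z).
    { pose proof (Z.div_mod (2 * a + b) (2 * b)) as E1.
      pose proof (Z.mod_pos_bound (2 * a + b) (2 * b)) as E2.
      fold c in E1; nia. }
    set (r := (a - c * b)%Z) in *.
    assert (Gr : Z.gcd r b = 1%Z).
    { rewrite <- G; unfold r; replace (a - c * b)%Z with (a + (- c) * b)%Z by ring.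
      rewrite Z.gcd_comm, (Z.gcd_comm a); apply Z.gcd_add_mult_diag_r. }
    replace a with (r + c * b)%Z by (unfold r; ring).
    apply HT; auto.
    (* A zero remainder forces [b = 1] by coprimality, which is the base case; otherwise the next
       denominator [Z.abs r] is at most [b / 2] and the bound [n] applies. *)
    destruct (Z.eq_dec r 0) as [E|E].
    - rewrite E in *; rewrite Z.gcd_0_l in Gr; replace b with 1%Z by lia; auto.
    - apply HI; auto; apply IH; [lia|lia|].
      rewrite Z.gcd_abs_r, Z.gcd_opp_l.
      destruct (Z.sgn_spec r) as [[_ ->]|[[? _]|[_ ->]]]; [|lia|].
      + now rewrite Z.mul_1_r, Z.gcd_comm.
      + now rewrite Z.mul_opp_r, Z.mul_1_r, Z.gcd_opp_l, Z.gcd_comm. }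
  intros a b Hb; apply (K (Z.to_nat b)); lia.
Qed.

Lemma opp_inv_frac a b :
  (0 < b)%Z -> a <> 0%Z ->
  IZR (- (b * Z.sgn a)) / IZR (Z.abs a) = - / (IZR a / IZR b).
Proof.
  intros Hb Ha.
  assert (0 < IZR b) by (apply (IZR_lt 0); auto).
  assert (IZR a <> 0) by (apply not_0_IZR; auto).
  destruct (Z.sgn_spec a) as [[L E]|[[L E]|[L E]]]; [|lia|]; rewrite E.
  - rewrite Z.mul_1_r, Z.abs_eq, opp_IZR by lia; field; lra.
  - rewrite Z.mul_opp_r, Z.mul_1_r, Z.abs_neq, Z.opp_involutive, opp_IZR by lia.
    field; lra.
Qed.

Lemma fdag_Qc f q : fdag f (QcR q) = f q.
Proof.
  unfold fdag.
  match goal with |- epsilon ?i ?P = _ => pose proof (epsilon_spec i P) as H end.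
  destruct H as [(p & E & Hp)|[N _]].
  - exists (f q); left; exists q; auto.
  - rewrite Hp; f_equal; now apply QcR_inj.
  - destruct N; exists q; auto.
Qed.

Lemma fdag_irrational f x L :
  ~ is_rational x -> rat_lim f x L -> rat_lim f x (fdag f x).
Proof.
  intros N HL; unfold fdag.
  match goal with |- context [epsilon ?i ?P] => pose proof (epsilon_spec i P) as H end.
  destruct H as [(p & E & Hp)|[_ H]]; [exists L; auto| |exact H].
  destruct N; exists p; auto.
Qed.

(** Irrationality makes the puncture [QcR y <> x] automatic, so a limit of [f] over [Qc] becomes a
    limit of [fdag f] inside [R]. *)
Lemma rat_lim_fdag f x L :
  ~ is_rational x -> (rat_lim f x L <-> lim_on is_rational (fdag f) x L).
Proof.
  intros N; split; intros H e He; destruct (H e He) as (d & Hd & K);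
    exists d; split; auto.
  - intros y [q <-] Hy; rewrite fdag_Qc; apply K; auto.
    intros E; apply N; exists q; auto.
  - intros q _ Hq; rewrite <- fdag_Qc; apply K; auto; exists q; auto.
Qed.

(** * Two-point derivatives *)

(** Stated without division and with a weak inequality, so that [y = x] needs no exception. *)
Definition der_on (D : R -> Prop) (f : R -> C) (x : R) (l : C) : Prop :=
  forall w, 0 < w ->
    near x (fun y => D y -> Cmod (f y - f x - l * RtoC (y - x)) <= w * Rabs (y - x)).

Notation der := (der_on (fun _ => True)).

(** The error [w] stays fixed instead of being quantified away: it plays the role of an oscillation
    of the difference quotients, and is the quantity that contracts. *)
Definition approx_slope (f : R -> C) (x : R) (l : C) (w : R) : Prop :=
  exists d, 0 < d /\ forall y z, Rabs (y - x) < d -> Rabs (z - x) < d ->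
    Cmod (f y - f z - l * RtoC (y - z)) <= w * Rabs (y - z).

Definition strict_der (f : R -> C) (x : R) (l : C) : Prop :=
  forall w, 0 < w -> approx_slope f x l w.

Lemma im_le_Cmod (z : C) : Rabs (Im z) <= Cmod z.
Proof. eapply Rle_trans; [exact (Rmax_r (Rabs (fst z)) _)|exact (Rmax_Cmod z)]. Qed.

Lemma quotient_der_on (D : R -> Prop) (f : R -> C) (x : R) (l : C) :
  filterlim (fun y => ((f y - f x) / RtoC (y - x))%C)
    (within (fun y => D y /\ y <> x) (locally x)) (locally l) <->
  der_on D f x l.
Proof.
  rewrite filterlim_lim_on.
  assert (Hq : forall y, y <> x ->
    Cmod (f y - f x - l * RtoC (y - x)) =
    Cmod ((f y - f x) / RtoC (y - x) - l) * Rabs (y - x)).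
  { intros y Hy; rewrite <- Cmod_R, <- Cmod_mult; f_equal.
    field; intros E; apply RtoC_inj in E; lra. }
  split; intros H.
  - intros w Hw; destruct (H w Hw) as (d & Hd & K); exists d; split; auto.
    intros y Hy Dy; destruct (Req_dec y x) as [->|Ny].
    + replace (x - x) with 0 by ring; rewrite Rabs_R0.
      replace (f x - f x - l * RtoC 0)%C with (RtoC 0) by ring; rewrite Cmod_0; lra.
    + rewrite Hq by auto; apply Rmult_le_compat_r; [apply Rabs_pos|].
      left; apply K; auto.
  - intros e He; destruct (H (e / 2)) as (d & Hd & K); [lra|]; exists d; split; auto.
    intros y [Dy Ny] Hy; specialize (K y Hy Dy); rewrite Hq in K by auto.
    apply Rle_lt_trans with (e / 2); [|lra].
    apply Rmult_le_reg_r with (Rabs (y - x)); auto; apply Rabs_pos_lt; lra.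
Qed.

Lemma strict_der_der f x l : strict_der f x l -> der f x l.
Proof.
  intros H w Hw; destruct (H w Hw) as (d & Hd & K); exists d; split; auto.
  intros y Hy _; apply K; auto; replace (x - x) with 0 by ring; now rewrite Rabs_R0.
Qed.

Lemma der_on_open (D : R -> Prop) f x l : near x D -> der_on D f x l -> der f x l.
Proof.
  intros HD H w Hw; eapply near_impl; [|apply (near_and _ _ _ HD (H w Hw))].
  intros y [A B] _; auto.
Qed.

Lemma der_on_sub (D1 D2 : R -> Prop) f x l :
  (forall y, D2 y -> D1 y) -> der_on D1 f x l -> der_on D2 f x l.
Proof.
  intros HD H w Hw; eapply near_impl; [|apply (H w Hw)]; simpl; auto.
Qed.

Lemma der_unique f x l1 l2 : der f x l1 -> der f x l2 -> l1 = l2.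
Proof.
  intros A B; apply Cmod_small_eq; intros e He.
  destruct (near_and _ _ _ (A (e / 4) ltac:(lra)) (B (e / 4) ltac:(lra))) as (d & Hd & K).
  destruct (K (x + d / 2)) as [K1 K2].
  { replace (x + d / 2 - x) with (d / 2) by ring; rewrite Rabs_pos_eq; lra. }
  specialize (K1 I); specialize (K2 I).
  replace (x + d / 2 - x) with (d / 2) in * by ring.
  rewrite (Rabs_pos_eq (d / 2)) in * by lra.
  set (a := (f (x + d / 2)%R - f x)%C) in *.
  assert (E : Cmod (l1 - l2) * (d / 2) <= e / 2 * (d / 2)).
  { rewrite <- (Rabs_pos_eq (d / 2)) at 1 by lra; rewrite <- Cmod_R, <- Cmod_mult.
    replace ((l1 - l2) * RtoC (d / 2))%C with
      ((a - l2 * RtoC (d / 2)) - (a - l1 * RtoC (d / 2)))%C by ring.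
    eapply Rle_trans; [apply Cmod_triangle|]; rewrite Cmod_opp; lra. }
  apply Rmult_le_reg_r in E; lra.
Qed.

Lemma der_lim f x l : der f x l -> lim_on (fun _ => True) f x (f x).
Proof.
  intros H e He; destruct (H 1) as (d & Hd & K); [lra|].
  set (c := Cmod l + 1).
  assert (Hc : 0 < c) by (unfold c; pose proof (Cmod_ge_0 l); lra).
  exists (Rmin d (e / c)); split; [apply Rmin_pos; auto; now apply Rdiv_lt_0_compat|].
  intros y _ Hy; pose proof (Rmin_l d (e / c)); pose proof (Rmin_r d (e / c)).
  specialize (K y ltac:(lra) I).
  replace (f y - f x)%C with ((f y - f x - l * RtoC (y - x)) + l * RtoC (y - x))%C by ring.
  eapply Rle_lt_trans; [apply Cmod_triangle|]; rewrite (Cmod_mult l), Cmod_R.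
  apply Rle_lt_trans with (c * Rabs (y - x)); [unfold c; lra|].
  apply Rlt_le_trans with (c * (e / c)); [apply Rmult_lt_compat_l; lra|].
  right; field; lra.
Qed.

Lemma der_components f x l :
  is_derive (fun y => Re (f y)) x (Re l) -> is_derive (fun y => Im (f y)) x (Im l) ->
  der f x l.
Proof.
  intros A B w Hw; apply is_derive_Reals in A; apply is_derive_Reals in B.
  destruct (A (w / 2)) as [d1 K1]; [lra|]; destruct (B (w / 2)) as [d2 K2]; [lra|].
  exists (Rmin d1 d2); split; [apply Rmin_pos; apply cond_pos|].
  intros y Hy _; pose proof (Rmin_l d1 d2); pose proof (Rmin_r d1 d2).
  destruct (Req_dec y x) as [->|Ny].
  - replace (x - x) with 0 by ring; rewrite Rabs_R0.
    replace (f x - f x - l * RtoC 0)%C with (RtoC 0) by ring; rewrite Cmod_0; lra.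
  - specialize (K1 (y - x) ltac:(lra) ltac:(lra)).
    specialize (K2 (y - x) ltac:(lra) ltac:(lra)).
    replace (x + (y - x)) with y in * by ring.
    assert (Hpos : 0 < Rabs (y - x)) by (apply Rabs_pos_lt; lra).
    assert (E : forall a b c, (a - b) / (y - x) - c = (a - b - c * (y - x)) / (y - x)).
    { intros; field; lra. }
    rewrite E, Rabs_div in K1, K2 by lra.
    eapply Rle_trans; [apply Cmod_Re_Im|].
    replace (Re (f y - f x - l * RtoC (y - x))) with (Re (f y) - Re (f x) - Re l * (y - x))
      by (unfold Re; simpl; ring).
    replace (Im (f y - f x - l * RtoC (y - x))) with (Im (f y) - Im (f x) - Im l * (y - x))
      by (unfold Im; simpl; ring).
    set (a := Rabs (Re (f y) - Re (f x) - Re l * (y - x))) in *.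
    set (b := Rabs (Im (f y) - Im (f x) - Im l * (y - x))) in *.
    assert (a <= w / 2 * Rabs (y - x)).
    { replace a with (a / Rabs (y - x) * Rabs (y - x)) by (field; lra).
      apply Rmult_le_compat_r; lra. }
    assert (b <= w / 2 * Rabs (y - x)).
    { replace b with (b / Rabs (y - x) * Rabs (y - x)) by (field; lra).
      apply Rmult_le_compat_r; lra. }
    lra.
Qed.

Lemma der_component (p : C -> R) f x l :
  (forall (u v : C) (t : R), p (u - v * RtoC t)%C = p u - p v * t) ->
  (forall u v : C, p (u - v)%C = p u - p v) ->
  (forall u : C, Rabs (p u) <= Cmod u) ->
  der f x l -> derivable_pt_lim (fun y => p (f y)) x (p l).
Proof.
  intros P1 P2 P3 H e He; destruct (H (e / 2)) as (d & Hd & K); [lra|].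
  exists (mkposreal d Hd); intros t Nt Ht.
  assert (Hpos : 0 < Rabs t) by now apply Rabs_pos_lt.
  specialize (K (x + t)).
  replace (x + t - x) with t in K by ring.
  specialize (K Ht I); specialize (P3 (f (x + t)%R - f x - l * RtoC t)%C).
  rewrite P1, P2 in P3.
  replace ((p (f (x + t)) - p (f x)) / t - p l) with
    ((p (f (x + t)) - p (f x) - p l * t) / t) by (field; auto).
  rewrite Rabs_div by auto.
  apply Rle_lt_trans with (e / 2); [|lra].
  apply Rmult_le_reg_r with (Rabs t); auto.
  unfold Rdiv at 1; rewrite Rmult_assoc, Rinv_l by lra; lra.
Qed.

(** The real mean value theorem is applied to the real and imaginary parts separately; adding the
    two estimates costs the factor 2. *)
Lemma Cmod_mean_value f f' B a b :
  (forall c, Rmin a b <= c <= Rmax a b -> der f c (f' c) /\ Cmod (f' c) <= B) ->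
  Cmod (f b - f a) <= 2 * B * Rabs (b - a).
Proof.
  assert (K : forall a b, a < b ->
    (forall c, a <= c <= b -> der f c (f' c) /\ Cmod (f' c) <= B) ->
    Cmod (f b - f a) <= 2 * B * (b - a)).
  { clear a b; intros a b Hab H.
    eapply Rle_trans; [apply Cmod_Re_Im|].
    assert (G : forall p : C -> R,
      (forall (u v : C) (t : R), p (u - v * RtoC t)%C = p u - p v * t) ->
      (forall u v : C, p (u - v)%C = p u - p v) ->
      (forall u : C, Rabs (p u) <= Cmod u) ->
      Rabs (p (f b - f a)%C) <= B * (b - a)).
    { intros p P1 P2 P3; rewrite P2.
      destruct (MVT_cor2 (fun y => p (f y)) (fun y => p (f' y)) a b Hab) as (c & E & Hc).
      - intros c Hc; apply der_component; auto; apply H, Hc.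
      - rewrite E, Rabs_mult, (Rabs_pos_eq (b - a)) by lra.
        apply Rmult_le_compat_r; [lra|].
        eapply Rle_trans; [apply P3|]; apply H; lra. }
    assert (Rabs (Re (f b - f a)%C) <= B * (b - a)).
    { apply G; [intros; unfold Re; simpl; ring|intros; reflexivity|intros; apply re_le_Cmod]. }
    assert (Rabs (Im (f b - f a)%C) <= B * (b - a)).
    { apply G; [intros; unfold Im; simpl; ring|intros; reflexivity|intros; apply im_le_Cmod]. }
    lra. }
  intros H; destruct (Rtotal_order a b) as [L|[->|L]].
  - rewrite (Rabs_pos_eq (b - a)) by lra; apply K; auto.
    rewrite Rmin_left, Rmax_right in H by lra; auto.
  - replace (f b - f b)%C with (RtoC 0) by ring; rewrite Cmod_0.
    replace (b - b) with 0 by ring; rewrite Rabs_R0; lra.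
  - rewrite Cmod_minus_sym, Rabs_minus_sym, (Rabs_pos_eq (a - b)) by lra; apply K; auto.
    rewrite Rmin_right, Rmax_left in H by lra; auto.
Qed.

(** The mean value estimate applied to [t |-> f t - f' x * t], whose derivative is at most [w / 2]
    near [x]. *)
Lemma C1_strict_der f f' x :
  near x (fun y => der f y (f' y)) -> lim_on (fun _ => True) f' x (f' x) ->
  strict_der f x (f' x).
Proof.
  intros (d1 & H1 & K1) Hc w Hw.
  destruct (Hc (w / 2)) as (d2 & H2 & K2); [lra|].
  exists (Rmin d1 d2); split; [now apply Rmin_pos|]; intros y z Hy Hz.
  pose proof (Rmin_l d1 d2); pose proof (Rmin_r d1 d2).
  set (l := f' x) in *.
  replace (f y - f z - l * RtoC (y - z))%C
    with ((f y - l * RtoC y) - (f z - l * RtoC z))%C by (rewrite RtoC_minus; ring).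
  replace (w * Rabs (y - z)) with (2 * (w / 2) * Rabs (y - z)) by field.
  apply Cmod_mean_value with (f := fun t => (f t - l * RtoC t)%C) (f' := fun t => (f' t - l)%C).
  intros c Hc'.
  assert (Hcx : Rabs (c - x) < Rmin d1 d2).
  { apply Rabs_def2 in Hy; apply Rabs_def2 in Hz; apply Rabs_def1;
    unfold Rmin, Rmax in Hc'; destruct (Rle_dec z y); lra. }
  split; [|left; apply K2; auto; lra].
  intros w' Hw'; eapply near_impl; [|apply (K1 c ltac:(lra) w' Hw')].
  intros u Hu _; simpl in Hu.
  replace (f u - l * RtoC u - (f c - l * RtoC c) - (f' c - l) * RtoC (u - c))%C
    with (f u - f c - f' c * RtoC (u - c))%C by (rewrite RtoC_minus; ring).
  auto.
Qed.

(** For [u] near [x], the slope of [f] between [u] and [u + t] is close to [f' x] by strictness at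
    [x], and close to [f' u] once [t] is small. *)
Lemma strict_der_continuous f f' x :
  (forall y, strict_der f y (f' y)) -> lim_on (fun _ => True) f' x (f' x).
Proof.
  intros H e He.
  destruct (H x (e / 4)) as (d & Hd & K); [lra|]; exists d; split; auto.
  intros u _ Hu.
  destruct (H u (e / 4)) as (d2 & Hd2 & K2); [lra|].
  (* Small enough for [u + t] to lie in the neighbourhood of [u] as well as in that of [x]. *)
  set (t := Rmin d2 (d - Rabs (u - x)) / 2).
  assert (Ht : 0 < t < d2 /\ t < d - Rabs (u - x)).
  { unfold t; pose proof (Rmin_pos d2 (d - Rabs (u - x)) Hd2 ltac:(lra)).
    pose proof (Rmin_l d2 (d - Rabs (u - x))); pose proof (Rmin_r d2 (d - Rabs (u - x))); lra. }
  specialize (K (u + t) u); specialize (K2 (u + t) u).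
  replace (u + t - u) with t in * by ring; replace (u - u) with 0 in K2 by ring.
  rewrite Rabs_R0 in K2; rewrite (Rabs_pos_eq t) in * by lra.
  specialize (K2 ltac:(lra) ltac:(lra)).
  assert (K' : Cmod (f (u + t) - f u - f' x * RtoC t) <= e / 4 * t).
  { apply K; auto; replace (u + t - x) with ((u - x) + t) by ring.
    eapply Rle_lt_trans; [apply Rabs_triang|]; rewrite (Rabs_pos_eq t); lra. }
  assert (E : Cmod (f' u - f' x) * t <= e / 2 * t).
  { rewrite <- (Rabs_pos_eq t) at 1 by lra; rewrite <- Cmod_R, <- Cmod_mult.
    replace ((f' u - f' x) * RtoC t)%C with
      ((f (u + t)%R - f u - f' x * RtoC t) - (f (u + t)%R - f u - f' u * RtoC t))%C by ring.
    eapply Rle_trans; [apply Cmod_triangle|]; rewrite Cmod_opp; lra. }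
  apply Rmult_le_reg_r in E; lra.
Qed.

Lemma approx_slope_lipschitz f x l w :
  approx_slope f x l w ->
  exists d, 0 < d /\ forall y z, Rabs (y - x) < d -> Rabs (z - x) < d ->
    Cmod (f y - f z) <= (Cmod l + w) * Rabs (y - z).
Proof.
  intros (d & Hd & K); exists d; split; auto; intros y z Hy Hz.
  specialize (K y z Hy Hz).
  replace (f y - f z)%C with ((f y - f z - l * RtoC (y - z)) + l * RtoC (y - z))%C by ring.
  eapply Rle_trans; [apply Cmod_triangle|]; rewrite (Cmod_mult l), Cmod_R; lra.
Qed.

Lemma approx_slope_le f x l w w' : w <= w' -> approx_slope f x l w -> approx_slope f x l w'.
Proof.
  intros H (d & Hd & K); exists d; split; auto; intros y z Hy Hz.
  eapply Rle_trans; [apply K; auto|]; apply Rmult_le_compat_r; [apply Rabs_pos|auto].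
Qed.

Lemma approx_slope_plus f g x l1 l2 w1 w2 :
  approx_slope f x l1 w1 -> approx_slope g x l2 w2 ->
  approx_slope (fun y => f y + g y)%C x (l1 + l2)%C (w1 + w2).
Proof.
  intros (d1 & H1 & K1) (d2 & H2 & K2).
  exists (Rmin d1 d2); split; [now apply Rmin_pos|]; intros y z Hy Hz.
  pose proof (Rmin_l d1 d2); pose proof (Rmin_r d1 d2).
  replace (f y + g y - (f z + g z) - (l1 + l2) * RtoC (y - z))%C with
    ((f y - f z - l1 * RtoC (y - z)) + (g y - g z - l2 * RtoC (y - z)))%C by ring.
  eapply Rle_trans; [apply Cmod_triangle|].
  specialize (K1 y z ltac:(lra) ltac:(lra)); specialize (K2 y z ltac:(lra) ltac:(lra)); lra.
Qed.

Lemma approx_slope_ext f g x l w :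
  near x (fun y => f y = g y) -> approx_slope f x l w -> approx_slope g x l w.
Proof.
  intros (d1 & H1 & K1) (d2 & H2 & K2).
  exists (Rmin d1 d2); split; [now apply Rmin_pos|]; intros y z Hy Hz.
  pose proof (Rmin_l d1 d2); pose proof (Rmin_r d1 d2).
  rewrite <- (K1 y), <- (K1 z) by lra; apply K2; lra.
Qed.

(* Product and chain rule at once; the error of [F] is only multiplied by
   [|P x| |c|], which is what makes the oscillation argument contract. *)
Lemma approx_slope_mult_comp (P F : R -> C) (phi : R -> R) x p c l w :
  strict_der P x p -> strict_der (fun y => RtoC (phi y)) x (RtoC c) ->
  0 <= w -> approx_slope F (phi x) l w ->
  forall e, 0 < e ->
  approx_slope (fun y => P y * F (phi y))%C x
    (p * F (phi x) + P x * l * RtoC c)%C (Cmod (P x) * Rabs c * w + e).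
Proof.
  intros HP Hphi Hw HF e He.
  set (K := Cmod l + w).
  (* [A] collects every coefficient that the small parameter [n] receives in the final estimate;
     [n * A <= e] then absorbs them all. *)
  set (A := Cmod (F (phi x)) + 1 + Cmod p + K * (Rabs c + 1) + Cmod (P x) * w
              + Cmod (P x) * Cmod l).
  pose proof (Cmod_ge_0 l) as Hl; pose proof (Cmod_ge_0 p) as Hp.
  pose proof (Cmod_ge_0 (P x)) as HPx; pose proof (Rabs_pos c) as Hc.
  pose proof (Cmod_ge_0 (F (phi x))) as HFx.
  assert (HK : 0 <= K) by (unfold K; lra).
  assert (N1 : 0 <= K * (Rabs c + 1)) by (apply Rmult_le_pos; lra).
  assert (N2 : 0 <= Cmod (P x) * w) by (apply Rmult_le_pos; lra).
  assert (N3 : 0 <= Cmod (P x) * Cmod l) by (apply Rmult_le_pos; lra).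
  assert (HA : 0 < A) by (unfold A; lra).
  set (n := Rmin 1 (e / A)).
  assert (Hn : 0 < n) by (apply Rmin_pos; [lra|now apply Rdiv_lt_0_compat]).
  assert (Hn1 : n <= 1) by apply Rmin_l.
  assert (HnA : n * A <= e).
  { apply Rle_trans with (e / A * A); [|right; field; lra].
    apply Rmult_le_compat_r; [lra|apply Rmin_r]. }
  destruct (HP n Hn) as (d1 & H1 & K1).
  destruct (approx_slope_lipschitz _ _ _ _ (HP n Hn)) as (d2 & H2 & K2).
  destruct (Hphi n Hn) as (d3 & H3 & K3).
  destruct (approx_slope_lipschitz _ _ _ _ (Hphi n Hn)) as (d4 & H4 & K4).
  destruct HF as (d5 & H5 & K5).
  destruct (approx_slope_lipschitz F (phi x) l w) as (d6 & H6 & K6).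
  { exists d5; auto. }
  (* Of the radii [d7], [d8], [d9], the first keeps [F (phi y)] within [n] of [F (phi x)], the
     second keeps [P z] within [n] of [P x], and the third keeps [phi] inside the region where [F]
     is controlled. *)
  set (d7 := n / (K * (Rabs c + 1) + 1)).
  assert (H7 : 0 < d7) by (apply Rdiv_lt_0_compat; lra).
  set (d8 := n / (Cmod p + 1)).
  assert (H8 : 0 < d8) by (apply Rdiv_lt_0_compat; lra).
  set (d9 := Rmin d5 d6 / (Rabs c + 1)).
  assert (H9 : 0 < d9) by (apply Rdiv_lt_0_compat; [now apply Rmin_pos|lra]).
  assert (Hd : exists d, 0 < d /\ d <= d1 /\ d <= d2 /\ d <= d3 /\ d <= d4 /\
                 d <= d7 /\ d <= d8 /\ d <= d9).
  { exists (Rmin d1 (Rmin d2 (Rmin d3 (Rmin d4 (Rmin d7 (Rmin d8 d9)))))).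
    repeat split; repeat apply Rmin_pos; auto;
    repeat (first [apply Rle_refl | apply Rmin_l | eapply Rle_trans; [apply Rmin_r|]]). }
  destruct Hd as (d & Hd & L1 & L2 & L3 & L4 & L7 & L8 & L9).
  exists d; split; auto; intros y z Hy Hz.
  assert (Hxx : Rabs (x - x) < d) by (replace (x - x) with 0 by ring; rewrite Rabs_R0; auto).
  assert (Dphi : forall u v, Rabs (u - x) < d -> Rabs (v - x) < d ->
            Rabs (phi u - phi v) <= (Rabs c + 1) * Rabs (u - v)).
  { intros u v Hu Hv; specialize (K4 u v ltac:(lra) ltac:(lra)).
    rewrite <- RtoC_minus, !Cmod_R in K4.
    eapply Rle_trans; [exact K4|]; apply Rmult_le_compat_r; [apply Rabs_pos|lra]. }
  assert (Bphi : forall u, Rabs (u - x) < d -> Rabs (phi u - phi x) < Rmin d5 d6).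
  { intros u Hu; specialize (Dphi u x Hu Hxx).
    eapply Rle_lt_trans; [exact Dphi|].
    apply Rlt_le_trans with ((Rabs c + 1) * d9); [apply Rmult_lt_compat_l; lra|].
    unfold d9; right; field; lra. }
  pose proof (Rmin_l d5 d6); pose proof (Rmin_r d5 d6).
  pose proof (Bphi y Hy) as By; pose proof (Bphi z Hz) as Bz; pose proof (Bphi x Hxx) as Bx.
  set (t := Rabs (y - z)); assert (Ht : 0 <= t) by apply Rabs_pos.
  assert (E1 : Cmod (P y - P z - p * RtoC (y - z)) <= n * t) by (apply K1; lra).
  assert (E2 : Cmod (F (phi y) - F (phi x)) <= n).
  { eapply Rle_trans; [apply K6; lra|]; fold K.
    apply Rle_trans with (K * ((Rabs c + 1) * Rabs (y - x))).
    - apply Rmult_le_compat_l; auto.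
    - apply Rle_trans with ((K * (Rabs c + 1) + 1) * d7).
      + rewrite <- Rmult_assoc; apply Rmult_le_compat; try lra; apply Rabs_pos.
      + unfold d7; right; field; lra. }
  assert (E3 : Cmod (P z - P x) <= n).
  { eapply Rle_trans; [apply K2; lra|].
    apply Rle_trans with ((Cmod p + 1) * d8).
    - apply Rmult_le_compat; try lra; apply Rabs_pos.
    - unfold d8; right; field; lra. }
  pose proof (Dphi y z Hy Hz) as E4; fold t in E4.
  assert (E5 : Cmod (F (phi y) - F (phi z)) <= K * ((Rabs c + 1) * t)).
  { eapply Rle_trans; [apply K6; lra|]; apply Rmult_le_compat_l; auto. }
  assert (E6 : Cmod (F (phi y) - F (phi z) - l * RtoC (phi y - phi z)) <= w * ((Rabs c + n) * t)).
  { eapply Rle_trans; [apply K5; lra|]; apply Rmult_le_compat_l; auto.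
    specialize (K4 y z ltac:(lra) ltac:(lra)); rewrite <- RtoC_minus, !Cmod_R in K4; exact K4. }
  assert (E7 : Rabs (phi y - phi z - c * (y - z)) <= n * t).
  { specialize (K3 y z ltac:(lra) ltac:(lra)).
    rewrite <- RtoC_minus, <- RtoC_mult, <- RtoC_minus, Cmod_R in K3; exact K3. }
  assert (E8 : Cmod (F (phi y)) <= Cmod (F (phi x)) + 1).
  { replace (F (phi y)) with ((F (phi y) - F (phi x)) + F (phi x))%C by ring.
    eapply Rle_trans; [apply Cmod_triangle|lra]. }
  (* Five errors: that of [P], the variation of [F] against the slope [p], a second-order product,
     that of [F], and that of [phi]. All are multiples of [n] except the fourth, which leaves
     [|P x| |c| w]. *)
  replace (P y * F (phi y) - P z * F (phi z) -
             (p * F (phi x) + P x * l * RtoC c) * RtoC (y - z))%C with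
    ((P y - P z - p * RtoC (y - z)) * F (phi y)
     + (p * RtoC (y - z) * (F (phi y) - F (phi x))
     + ((P z - P x) * (F (phi y) - F (phi z))
     + (P x * (F (phi y) - F (phi z) - l * RtoC (phi y - phi z))
     + P x * l * RtoC (phi y - phi z - c * (y - z))))))%C
    by (rewrite !RtoC_minus, RtoC_mult, !RtoC_minus; ring).
  apply Rle_trans with
    (n * t * (Cmod (F (phi x)) + 1) + (Cmod p * t * n + (n * (K * ((Rabs c + 1) * t))
     + (Cmod (P x) * (w * ((Rabs c + n) * t)) + Cmod (P x) * Cmod l * (n * t))))).
  - repeat (eapply Rle_trans; [apply Cmod_triangle|apply Rplus_le_compat]);
      rewrite ?Cmod_mult, ?Cmod_R.
    + apply Rmult_le_compat; auto; apply Cmod_ge_0.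
    + apply Rmult_le_compat_l; auto; apply Rmult_le_pos; auto.
    + apply Rmult_le_compat; auto; apply Cmod_ge_0.
    + apply Rmult_le_compat_l; auto.
    + apply Rmult_le_compat_l; auto; apply Rmult_le_pos; auto.
  - replace (_ + _) with ((n * A + Cmod (P x) * Rabs c * w) * t) by (unfold A; ring).
    apply Rmult_le_compat_r; lra.
Qed.

Lemma strict_der_mult_comp (P F : R -> C) (phi : R -> R) x p c l :
  strict_der P x p -> strict_der (fun y => RtoC (phi y)) x (RtoC c) ->
  strict_der F (phi x) l ->
  strict_der (fun y => P y * F (phi y))%C x (p * F (phi x) + P x * l * RtoC c)%C.
Proof.
  intros HP Hphi HF e He.
  pose proof (Cmod_ge_0 (P x)); pose proof (Rabs_pos c).
  set (a := Cmod (P x) * Rabs c).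
  assert (Ha : 0 <= a) by (apply Rmult_le_pos; auto).
  set (w := e / 2 / (a + 1)).
  assert (Hw : 0 < w) by (apply Rdiv_lt_0_compat; lra).
  eapply approx_slope_le;
    [|apply (approx_slope_mult_comp P F phi x p c l w HP Hphi ltac:(lra) (HF w Hw) (e / 2)); lra].
  fold a; assert ((a + 1) * w = e / 2) by (unfold w; field; lra); lra.
Qed.

(** * Continuity and strict derivatives of the inversion and of the powers of [|x|] *)

Lemma lim_on_RtoC D phi x :
  continuity_pt phi x -> lim_on D (fun y => RtoC (phi y)) x (RtoC (phi x)).
Proof.
  intros H e He; destruct (proj1 (continuity_pt_locally phi x) H (mkposreal e He)) as [d Hd].
  exists d; split; [apply cond_pos|]; intros y _ Hy.
  rewrite <- RtoC_minus, Cmod_R; apply Hd, Hy.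
Qed.

Lemma continuity_pt_inv_id x : x <> 0 -> continuity_pt (fun y => / y) x.
Proof.
  intros H; apply (continuity_pt_inv id x); auto.
  apply derivable_continuous_pt, derivable_pt_id.
Qed.

Lemma continuity_pt_opp_inv x : x <> 0 -> continuity_pt (fun y => - / y) x.
Proof. intros H; apply (continuity_pt_opp (fun y => / y)); now apply continuity_pt_inv_id. Qed.

Lemma near_nonzero x : x <> 0 -> near x (fun y => y <> 0).
Proof. intros H; apply (near_impl x (fun y => 0 < x * y)); [intros; nra|now apply near_neq0]. Qed.

Lemma strict_der_inv x : x <> 0 -> strict_der (fun y => RtoC (/ y)) x (RtoC (- / (x * x))).
Proof.
  intros H; apply (C1_strict_der _ (fun y => RtoC (- / (y * y)))).
  - apply near_impl with (2 := near_nonzero x H); intros y Hy; apply der_components; simpl.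
    + auto_derive; auto; field; auto.
    + apply (is_derive_const (K := R_AbsRing) (V := R_NormedModule) 0).
  - apply (lim_on_RtoC _ (fun y => - / (y * y))).
    apply (continuity_pt_opp (fun y => / (y * y))).
    apply (continuity_pt_inv (fun y => y * y)); [|nra].
    apply continuity_pt_mult; apply derivable_continuous_pt, derivable_pt_id.
Qed.

Lemma strict_der_opp_inv x : x <> 0 -> strict_der (fun y => RtoC (- / y)) x (RtoC (/ (x * x))).
Proof.
  intros H w Hw; destruct (strict_der_inv x H w Hw) as (d & Hd & K).
  exists d; split; auto; intros y z Hy Hz.
  rewrite <- Cmod_opp; eapply Rle_trans; [right|exact (K y z Hy Hz)]; f_equal.
  rewrite !RtoC_opp; ring.
Qed.

(** The right side is differentiated by one formula on both sides of [0], which avoids a case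
    distinction on the sign of [x]. *)
Lemma ln_Rabs x : x <> 0 -> ln (Rabs x) = ln (x * x) / 2.
Proof.
  intros H; pose proof (Rabs_pos_lt x H).
  replace (x * x) with (Rabs x * Rabs x).
  - rewrite ln_mult by auto; field.
  - unfold Rabs; destruct (Rcase_abs x); ring.
Qed.

Lemma der_cpow_abs p x :
  x <> 0 -> der (fun y => cpow (Rabs y) p) x (p * (cpow (Rabs x) p * RtoC (/ x)))%C.
Proof.
  intros H; destruct p as [a b].
  apply der_components.
  - eapply is_derive_ext_loc with
      (f := fun y => exp (a * (ln (y * y) / 2)) * cos (b * (ln (y * y) / 2))).
    + destruct (near_nonzero x H) as (d & Hd & K); exists (mkposreal d Hd).
      intros y Hy; unfold cpow, cexp; simpl; rewrite ln_Rabs by (apply K, Hy).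
      f_equal; f_equal; ring.
    + unfold cpow, cexp; simpl; rewrite ln_Rabs by auto.
      replace (a * (ln (x * x) / 2) - b * 0) with (a * (ln (x * x) / 2)) by ring.
      replace (a * 0 + b * (ln (x * x) / 2)) with (b * (ln (x * x) / 2)) by ring.
      auto_derive; [nra|]; unfold Rdiv; generalize (ln (x * x) * / 2); intros u; field; auto.
  - eapply is_derive_ext_loc with
      (f := fun y => exp (a * (ln (y * y) / 2)) * sin (b * (ln (y * y) / 2))).
    + destruct (near_nonzero x H) as (d & Hd & K); exists (mkposreal d Hd).
      intros y Hy; unfold cpow, cexp; simpl; rewrite ln_Rabs by (apply K, Hy).
      f_equal; f_equal; ring.
    + unfold cpow, cexp; simpl; rewrite ln_Rabs by auto.
      replace (a * (ln (x * x) / 2) - b * 0) with (a * (ln (x * x) / 2)) by ring.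
      replace (a * 0 + b * (ln (x * x) / 2)) with (b * (ln (x * x) / 2)) by ring.
      auto_derive; [nra|]; unfold Rdiv; generalize (ln (x * x) * / 2); intros u; field; auto.
Qed.

(* The factor [x^(-j)] makes this family stable under differentiation without [sign x]. *)
Definition pw (j : nat) (p : C) (x : R) : C := (cpow (Rabs x) p * RtoC ((/ x) ^ j))%C.

Lemma pw_S j p x : pw (S j) p x = (pw j p x * RtoC (/ x))%C.
Proof. unfold pw; simpl; rewrite !RtoC_mult; ring. Qed.

Lemma pw_0 p x : pw 0 p x = cpow (Rabs x) p.
Proof. unfold pw; simpl; ring. Qed.

Lemma lim_cpow_abs D p x :
  x <> 0 -> lim_on D (fun y => cpow (Rabs y) p) x (cpow (Rabs x) p).
Proof.
  intros H; apply (lim_on_sub (fun _ => True)); auto.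
  eapply der_lim, der_cpow_abs; auto.
Qed.

Lemma strict_der_cpow_abs p x :
  x <> 0 -> strict_der (fun y => cpow (Rabs y) p) x (p * (cpow (Rabs x) p * RtoC (/ x)))%C.
Proof.
  intros H.
  apply (C1_strict_der _ (fun x => p * (cpow (Rabs x) p * RtoC (/ x)))%C).
  - apply near_impl with (2 := near_nonzero x H); intros; now apply der_cpow_abs.
  - apply lim_on_mult; [apply lim_on_const|]; apply lim_on_mult; [now apply lim_cpow_abs|].
    apply lim_on_RtoC; now apply continuity_pt_inv_id.
Qed.

Lemma strict_der_ext f g x l l' :
  near x (fun y => f y = g y) -> l = l' -> strict_der f x l -> strict_der g x l'.
Proof. intros H -> K w Hw; eapply approx_slope_ext; eauto. Qed.

Lemma strict_der_RtoC x : strict_der RtoC x 1%C.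
Proof.
  intros w Hw; exists 1; split; [lra|]; intros y z _ _.
  replace (RtoC y - RtoC z - 1 * RtoC (y - z))%C with (RtoC 0) by (rewrite RtoC_minus; ring).
  rewrite Cmod_0; apply Rmult_le_pos; [lra|apply Rabs_pos].
Qed.

Lemma strict_der_pw j p x :
  x <> 0 -> strict_der (pw j p) x ((p - RtoC (INR j)) * pw (S j) p x)%C.
Proof.
  intros H; induction j as [|j IH].
  - eapply strict_der_ext; [| |apply (strict_der_cpow_abs p x H)].
    + exists 1; split; [lra|]; intros; now rewrite pw_0.
    + rewrite pw_S, pw_0; simpl; ring.
  (* The extra factor [/ x] is read as [RtoC] composed with [y |-> / y], so that the combined
     product and chain rule applies. *)
  - eapply strict_der_ext; [| |
      apply (strict_der_mult_comp (pw j p) RtoC (fun y => / y) x _ (- / (x * x)) 1 IH)].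
    + exists 1; split; [lra|]; intros; now rewrite pw_S.
    + rewrite S_INR, !pw_S, RtoC_plus, RtoC_opp, Rinv_mult, RtoC_mult; ring.
    + now apply strict_der_inv.
    + apply strict_der_RtoC.
Qed.

Lemma Cmod_pw j p x : x <> 0 -> Cmod (pw j p x) = Rpower (Rabs x) (Re p - INR j).
Proof.
  intros H; pose proof (Rabs_pos_lt x H) as Hx.
  unfold pw; rewrite Cmod_mult, Cmod_cpow, Cmod_R, <- RPow_abs, Rabs_inv.
  unfold Rminus; rewrite Rpower_plus, Rpower_Ropp, Rpower_pow, pow_inv by auto; reflexivity.
Qed.

Lemma Rpower_small a e : 0 < a -> 0 < e ->
  exists d, 0 < d /\ forall t, 0 < t < d -> Rpower t a < e.
Proof.
  intros Ha He; exists (Rpower e (/ a)); split; [apply Rpower_pos|].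
  intros t [Ht1 Ht2]; replace e with (Rpower (Rpower e (/ a)) a).
  - apply Rlt_Rpower_l; auto.
  - rewrite Rpower_mult, Rinv_l, Rpower_1 by lra; reflexivity.
Qed.

Lemma lim_pw_0 j p : INR j < Re p -> lim_on (fun y => y <> 0) (pw j p) 0 0%C.
Proof.
  intros H e He; destruct (Rpower_small (Re p - INR j) e) as (d & Hd & K); [lra|auto|].
  exists d; split; auto; intros y Ny Hy.
  replace (pw j p y - 0)%C with (pw j p y) by ring; rewrite Cmod_pw by auto.
  apply K; split; [now apply Rabs_pos_lt|]; now rewrite Rminus_0_r in Hy.
Qed.

(** * Boundedness and oscillation *)

(** Compactness provides a uniform positive lower bound for a gauge. The gauge is therefore chosen
    to serve twice: as a radius, and through its inverse as a local bound of [g]; a lower bound [d]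
    then gives the global bound [/ d]. *)
Lemma locally_bounded_bounded (D : R -> Prop) (g : R -> C) a b :
  (forall x, a <= x <= b -> exists M, near x (fun y => D y -> Cmod (g y) <= M)) ->
  exists M, forall y, a <= y <= b -> D y -> Cmod (g y) <= M.
Proof.
  intros H.
  assert (H' : forall x, exists d : posreal, a <= x <= b ->
            forall y, Rabs (y - x) < d -> D y -> Cmod (g y) <= / d).
  { intros x; destruct (classic (a <= x <= b)) as [Hx|Hx].
    2: { exists (mkposreal 1 Rlt_0_1); tauto. }
    destruct (H x Hx) as (M & d & Hd & K).
    set (m := / (Rabs M + 1)).
    assert (Hm : 0 < m) by (apply Rinv_0_lt_compat; pose proof (Rabs_pos M); lra).
    exists (mkposreal (Rmin d m) (Rmin_pos _ _ Hd Hm)); intros _ y Hy Dy; simpl in *.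
    pose proof (Rmin_l d m); pose proof (Rmin_r d m).
    apply Rle_trans with (1 := K y ltac:(lra) Dy).
    apply Rle_trans with (/ m).
    - unfold m; rewrite Rinv_inv; pose proof (Rle_abs M); lra.
    - apply Rinv_le_contravar; auto; now apply Rmin_pos. }
  set (delta := fun x => proj1_sig (constructive_indefinite_description _ (H' x))).
  assert (Hdelta : forall x, a <= x <= b ->
            forall y, Rabs (y - x) < delta x -> D y -> Cmod (g y) <= / delta x).
  { intros x; unfold delta.
    exact (proj2_sig (constructive_indefinite_description _ (H' x))). }
  destruct (compactness_value_1d a b delta) as [d Hd].
  exists (/ d); intros y Hy Dy; apply NNPP; intros N; apply (Hd y Hy).
  intros (t & Ht & Hyt & Hdt); apply N.
  eapply Rle_trans; [apply (Hdelta t Ht y Hyt Dy)|].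
  apply Rinv_le_contravar; auto; apply cond_pos.
Qed.

(* [W x w] stands for "some oscillation at [x] is at most [w]"; translating into
   [-1/2, 1/2] and applying [x |-> -1/x] shrinks it by the factor [q]. *)
Lemma oscillation_vanishes (D : R -> Prop) (W : R -> R -> Prop) B q :
  0 <= B -> 0 <= q < 1 ->
  (forall x n, D x -> D (x + IZR n)) -> (forall x, D x -> D (- / x)) ->
  (forall x, D x -> W x B) ->
  (forall x n w, D x -> W (x + IZR n) w -> W x w) ->
  (forall x w, D x -> Rabs x <= 1 / 2 -> 0 <= w ->
     (x <> 0 -> W (- / x) w) -> W x (q * w)) ->
  forall x e, D x -> 0 < e -> exists w, 0 <= w < e /\ W x w.
Proof.
  intros HB Hq DT DI WB WT WI x e Dx He.
  assert (K : forall n x, D x -> W x (q ^ n * B)).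
  { induction n as [|n IH]; intros y Dy.
    - simpl; rewrite Rmult_1_l; auto.
    - destruct (nearest_int y) as [m Hm].
      apply (WT y m); auto; simpl; rewrite Rmult_assoc; apply WI; auto.
      apply Rmult_le_pos; [apply pow_le; lra|auto]. }
  destruct (pow_lt_1_zero q) with (y := e / (B + 1)) as [N HN].
  - rewrite Rabs_pos_eq; lra.
  - apply Rdiv_lt_0_compat; lra.
  - exists (q ^ N * B); split; [|now apply K].
    specialize (HN N (le_n N)); pose proof (pow_le q N ltac:(lra)).
    rewrite Rabs_pos_eq in HN by auto; split; [now apply Rmult_le_pos|].
    apply Rle_lt_trans with (q ^ N * (B + 1)); [apply Rmult_le_compat_l; lra|].
    apply Rlt_le_trans with (e / (B + 1) * (B + 1)); [apply Rmult_lt_compat_r; lra|].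
    right; field; lra.
Qed.

Definition periodic_on (D : R -> Prop) (F : R -> C) : Prop :=
  forall x n, D x -> F (x + IZR n) = F x.

(** The open interval is where [h] is continuous on full neighbourhoods, apart from [0]; the
    translated points, with [|x| <= 1/2], or [3/4] for pairs, stay inside it. The set [D] is first
    the rationals, later all of [R]. *)
Definition cocycle_on (D : R -> Prop) (p : C) (F h : R -> C) : Prop :=
  forall x, D x -> x <> 0 -> Rabs x < 1 ->
    F x = (h x + cpow (Rabs x) p * F (- / x)%R)%C.

Lemma periodic_on_step (D : R -> Prop) F :
  (forall x n, D x -> D (x + IZR n)) ->
  (forall x, D x -> F (x + 1) = F x) -> periodic_on D F.
Proof.
  intros HD H1.
  assert (K : forall n : nat, forall x, D x -> F (x + INR n) = F x).
  { induction n as [|n IH]; intros x Dx; [f_equal; simpl; ring|].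
    rewrite S_INR, <- Rplus_assoc, H1; auto.
    rewrite INR_IZR_INZ; auto. }
  intros x n Dx; destruct (Z_le_gt_dec 0 n) as [L|L].
  - rewrite <- (Z2Nat.id n L), <- INR_IZR_INZ; auto.
  - rewrite <- (K (Z.to_nat (- n)) (x + IZR n)) by auto; f_equal.
    rewrite INR_IZR_INZ, Z2Nat.id, opp_IZR by lia; ring.
Qed.

(** On [|x| <= 1/2] an inversion turns a bound [M] into [H + q M], which is again at most [M] as
    soon as [M >= H / (1 - q)]. Every rational descends to [0], so [M] must also dominate [F 0]. *)
Lemma cocycle_bounded_rational p F h :
  0 < Re p -> periodic_on is_rational F -> cocycle_on is_rational p F h ->
  (exists H, forall y, - (1/2) <= y <= 1/2 -> y <> 0 -> Cmod (h y) <= H) ->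
  exists M, 0 <= M /\ forall x, is_rational x -> Cmod (F x) <= M.
Proof.
  intros Hp HT HF [H HH].
  set (q := Rpower (1 / 2) (Re p)).
  assert (Hq : 0 < q < 1) by (split; [apply Rpower_pos|apply Rpower_lt_1; lra]).
  set (M := Rmax (Cmod (F 0)) (H / (1 - q))).
  assert (HM : 0 <= M).
  { eapply Rle_trans; [apply Cmod_ge_0|apply Rmax_l]. }
  assert (HM2 : H + q * M <= M).
  { assert (H <= (1 - q) * M); [|lra].
    apply Rle_trans with ((1 - q) * (H / (1 - q))); [right; field; lra|].
    apply Rmult_le_compat_l; [lra|apply Rmax_r]. }
  exists M; split; auto; intros x Hx.
  destruct (is_rational_coprime x Hx) as (a & b & Hb & G & ->); clear Hx.
  revert a b Hb G; apply coprime_ind.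
  - replace (0 / 1) with 0 by field; apply Rmax_l.
  - intros a b n Hb K.
    replace (IZR (a + n * b) / IZR b) with (IZR a / IZR b + IZR n).
    + rewrite HT; auto; now apply is_rational_frac.
    + rewrite plus_IZR, mult_IZR; field; apply not_0_IZR; lia.
  - intros a b Hb Ha Hab K; rewrite opp_inv_frac in K by auto.
    set (x := IZR a / IZR b) in *.
    assert (Hb' : 0 < IZR b) by (apply (IZR_lt 0); auto).
    assert (Hx0 : x <> 0).
    { unfold x, Rdiv; apply Rmult_integral_contrapositive_currified;
        [now apply not_0_IZR|apply Rinv_neq_0_compat; lra]. }
    assert (Hx : Rabs x <= 1 / 2).
    { unfold x; rewrite Rabs_div, (Rabs_pos_eq (IZR b)), <- abs_IZR by lra.
      apply Rmult_le_reg_r with (IZR b); auto.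
      unfold Rdiv at 1; rewrite Rmult_assoc, Rinv_l by lra.
      apply IZR_le in Hab; rewrite mult_IZR in Hab; lra. }
    pose proof (Rabs_pos_lt x Hx0).
    rewrite HF; auto; [|now apply is_rational_frac|lra].
    eapply Rle_trans; [apply Cmod_triangle|]; rewrite Cmod_mult, Cmod_cpow.
    apply Rle_trans with (2 := HM2); apply Rplus_le_compat.
    + apply HH; auto; unfold Rabs in Hx; destruct (Rcase_abs x); lra.
    + apply Rmult_le_compat; auto; [left; apply Rpower_pos|apply Cmod_ge_0|].
      apply Rpower_le_base; lra.
Qed.

Lemma rational_cluster x d : 0 < d -> exists y, is_rational y /\ Rabs (y - x) < d.
Proof.
  intros Hd; destruct (rational_dense_right x d Hd) as (y & Hy & L).
  exists y; split; auto; rewrite Rabs_pos_eq; lra.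
Qed.

Lemma near_Rabs_lt x b : Rabs x < b -> near x (fun y => Rabs y < b).
Proof.
  intros H; apply Rabs_def2 in H; eapply near_impl; [|apply (near_lt x (- b) b); lra].
  intros y Hy; apply Rabs_def1; lra.
Qed.

Lemma near_comp (phi : R -> R) x P :
  continuity_pt phi x -> near (phi x) P -> near x (fun y => P (phi y)).
Proof.
  intros Hc (d & Hd & K).
  destruct (proj1 (continuity_pt_locally phi x) Hc (mkposreal d Hd)) as [e He].
  exists e; split; [apply cond_pos|]; intros y Hy; apply K, He, Hy.
Qed.

Lemma near_shift x t P : near (x + t) P -> near x (fun y => P (y + t)).
Proof.
  intros (d & Hd & K); exists d; split; auto; intros y Hy; apply K.
  now replace (y + t - (x + t)) with (y - x) by ring.
Qed.

Lemma lim_on_shift (D : R -> Prop) g x t l :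
  (forall y, D y -> D (y + t)) -> lim_on D g (x + t) l -> lim_on D (fun y => g (y + t)) x l.
Proof.
  intros HD H e He; destruct (H e He) as (d & Hd & K); exists d; split; auto.
  intros y Dy Hy; apply K; auto; now replace (y + t - (x + t)) with (y - x) by ring.
Qed.

(** The orbit of an irrational point never meets [0], so the contraction can be iterated
    indefinitely; [approx_complete] then converts vanishing oscillation into an actual limit. *)
Lemma cocycle_limit_irrational p F h M :
  0 < Re p -> periodic_on is_rational F -> cocycle_on is_rational p F h ->
  (forall x, x <> 0 -> Rabs x < 1 -> lim_on (fun _ => True) h x (h x)) ->
  0 <= M -> (forall x, is_rational x -> Cmod (F x) <= M) ->
  forall x, ~ is_rational x -> exists L, lim_on is_rational F x L.
Proof.
  intros Hp HT HF Hh HM HB x Nx.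
  set (q := Rpower (1 / 2) (Re p)).
  assert (Hq : 0 < q < 1) by (split; [apply Rpower_pos|apply Rpower_lt_1; lra]).
  set (A := fun (x : R) (l : C) e => near x (fun y => is_rational y -> Cmod (F y - l) <= e)).
  (* The slack [e'] absorbs the variation of [h] and of [|x|^p] at each inversion, so that these
     never add to the contracted quantity [w]. *)
  assert (osc : forall x e, ~ is_rational x -> 0 < e -> exists w, 0 <= w < e /\
                  forall e', 0 < e' -> exists l, A x l (w + e')).
  { clear x Nx.
    apply (oscillation_vanishes (fun x => ~ is_rational x)
             (fun x w => forall e', 0 < e' -> exists l, A x l (w + e')) M q); auto; try lra.
    - intros; now apply irrational_plus_IZR.
    - intros; now apply irrational_opp_inv.
    - intros x Nx e He; exists 0%C; exists 1; split; [lra|]; intros y _ Hy.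
      replace (F y - 0)%C with (F y) by ring; specialize (HB y Hy); lra.
    - intros x n w Nx H e He; destruct (H e He) as [l Hl]; exists l.
      apply near_shift in Hl; eapply near_impl; [|exact Hl]; intros y K Hy; simpl in K.
      rewrite <- (HT y n) by auto; apply K; now apply is_rational_plus_IZR.
    - intros x w Nx Hx Hw H e He.
      assert (Hx0 : x <> 0) by now apply irrational_neq_0.
      destruct (H Hx0 (e / 4)) as [l' Hl']; [lra|].
      apply near_comp with (phi := fun y => - / y) in Hl'; [|now apply continuity_pt_opp_inv].
      (* The approximate value at [- / x] is pushed through the equation. Budget: [e / 4] for [h],
         [e / 4] for the power times the bound [M], and [q * (w + e / 4)] for [F]. *)
      exists (h x + cpow (Rabs x) p * l')%C.
      destruct (Hh x Hx0 ltac:(lra) (e / 4)) as (d1 & H1 & K1); [lra|].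
      destruct (lim_cpow_abs (fun _ => True) p x Hx0 (e / (4 * (M + 1)))) as (d2 & H2 & K2).
      { apply Rdiv_lt_0_compat; lra. }
      assert (N1 : near x (fun y => Rabs (y - x) < Rmin d1 d2)).
      { exists (Rmin d1 d2); split; [now apply Rmin_pos|auto]. }
      pose proof (near_and _ _ _ N1 (near_and _ _ _ Hl'
        (near_and _ _ _ (near_nonzero x Hx0) (near_Rabs_lt x 1 ltac:(lra))))) as N.
      eapply near_impl; [|exact N]; clear N; simpl.
      intros y (Hy & Fy & Ny & Ly) Ry.
      pose proof (Rmin_l d1 d2); pose proof (Rmin_r d1 d2).
      specialize (Fy (is_rational_opp_inv y Ry)).
      specialize (K1 y I ltac:(lra)); specialize (K2 y I ltac:(lra)).
      rewrite HF by auto.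
      replace (h y + cpow (Rabs y) p * F (- / y)%R - (h x + cpow (Rabs x) p * l'))%C with
        ((h y - h x) + ((cpow (Rabs y) p - cpow (Rabs x) p) * F (- / y)%R
          + cpow (Rabs x) p * (F (- / y)%R - l')))%C by ring.
      eapply Rle_trans; [apply Cmod_triangle|].
      eapply Rle_trans; [apply Rplus_le_compat_l, Cmod_triangle|].
      rewrite !Cmod_mult, Cmod_cpow.
      assert (E1 : Rpower (Rabs x) (Re p) <= q).
      { apply Rpower_le_base; [|lra]; split; auto; now apply Rabs_pos_lt. }
      assert (E2 : Cmod (cpow (Rabs y) p - cpow (Rabs x) p) * Cmod (F (- / y)) <= e / 4).
      { apply Rle_trans with (e / (4 * (M + 1)) * (M + 1)); [|right; field; lra].
        apply Rmult_le_compat; try apply Cmod_ge_0; [lra|].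
        specialize (HB _ (is_rational_opp_inv y Ry)); lra. }
      assert (E3 : Rpower (Rabs x) (Re p) * Cmod (F (- / y) - l') <= q * (w + e / 4)).
      { apply Rmult_le_compat; auto; [left; apply Rpower_pos|apply Cmod_ge_0]. }
      assert (q * (e / 4) <= e / 4) by nra.
      lra. }
  destruct (approx_complete (A x)) as [L HL].
  - intros e He; destruct (osc x (e / 2) Nx) as (w & Hw & K); [lra|].
    destruct (K (e - w)) as [l Hl]; [lra|]; exists l.
    replace (w + (e - w)) with e in Hl by ring; exact Hl.
  - intros l e l' e' H H'.
    destruct (near_and _ _ _ H H') as (d & Hd & K).
    destruct (rational_cluster x d Hd) as (y & Ry & Hy).
    destruct (K y Hy) as [K1 K2]; specialize (K1 Ry); specialize (K2 Ry).
    eapply Rle_trans; [apply (Cmod_triangle3 _ (F y))|].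
    rewrite (Cmod_minus_sym l); lra.
  - exists L; intros e He; destruct (osc x (e / 4) Nx) as (w & Hw & K); [lra|].
    destruct (K (e / 4 - w)) as [l Hl]; [lra|].
    specialize (HL _ _ Hl); destruct Hl as (d & Hd & Kd).
    exists d; split; auto; intros y Ry Hy; specialize (Kd y Hy Ry).
    eapply Rle_lt_trans; [apply (Cmod_triangle3 _ l)|]; lra.
Qed.

(** The property of [fdag f] by which identities and bounds pass from the rationals to the reals;
    rational points carry no condition. *)
Definition rational_closure_fun (F : R -> C) : Prop :=
  forall x, ~ is_rational x -> lim_on is_rational F x (F x).

Lemma rational_approx F x d e :
  rational_closure_fun F -> 0 < d -> 0 < e ->
  exists y, is_rational y /\ Rabs (y - x) < d /\ Cmod (F y - F x) < e.
Proof.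
  intros HF Hd He; destruct (classic (is_rational x)) as [Rx|Nx].
  - exists x; split; auto; split.
    + replace (x - x) with 0 by ring; now rewrite Rabs_R0.
    + replace (F x - F x)%C with (RtoC 0) by ring; now rewrite Cmod_0.
  - destruct (HF x Nx e He) as (d1 & H1 & K1).
    destruct (rational_cluster x (Rmin d d1)) as (y & Ry & Hy); [now apply Rmin_pos|].
    pose proof (Rmin_l d d1); pose proof (Rmin_r d d1).
    exists y; split; auto; split; [lra|]; apply K1; auto; lra.
Qed.

(** Each real [y] near [x] is shadowed by a rational [z], close to [y] and with [F z] close to
    [F y]; the limit along the rationals then controls [F y]. *)
Lemma closure_continuous_irrational F x :
  rational_closure_fun F -> ~ is_rational x -> lim_on (fun _ => True) F x (F x).
Proof.
  intros HF Nx e He; destruct (HF x Nx (e / 2)) as (d & Hd & K); [lra|].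
  exists d; split; auto; intros y _ Hy.
  destruct (rational_approx F y (d - Rabs (y - x)) (e / 2)) as (z & Rz & Hz & Fz); auto; try lra.
  assert (Hzx : Rabs (z - x) < d).
  { replace (z - x) with ((z - y) + (y - x)) by ring.
    eapply Rle_lt_trans; [apply Rabs_triang|lra]. }
  specialize (K z Rz Hzx).
  eapply Rle_lt_trans; [apply (Cmod_triangle3 _ (F z))|].
  rewrite (Cmod_minus_sym (F y)); lra.
Qed.

Lemma closure_bounded F M :
  rational_closure_fun F -> (forall x, is_rational x -> Cmod (F x) <= M) ->
  forall x, Cmod (F x) <= M.
Proof.
  intros HF HM x; apply le_epsilon; intros e He.
  destruct (rational_approx F x 1 e HF) as (y & Ry & _ & Hy); [lra|auto|].
  replace (F x) with ((F x - F y) + F y)%C by ring.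
  eapply Rle_trans; [apply Cmod_triangle|]; rewrite Cmod_minus_sym.
  specialize (HM y Ry); lra.
Qed.

Lemma closure_periodic F :
  rational_closure_fun F -> periodic_on is_rational F -> periodic_on (fun _ => True) F.
Proof.
  intros HF HT x n _; destruct (classic (is_rational x)) as [Rx|Nx]; [auto|].
  apply (lim_on_unique is_rational F x); [apply rational_cluster| |now apply HF].
  apply (lim_on_near is_rational is_rational (fun y => F (y + IZR n)) F).
  - exists 1; split; [lra|]; intros y _ Ry; split; auto.
  - apply lim_on_shift; [intros; now apply is_rational_plus_IZR|].
    apply HF; now apply irrational_plus_IZR.
Qed.

(** At an irrational point both sides are limits, along the rationals, of expressions that agree
    there. *)
Lemma closure_cocycle p F h :
  rational_closure_fun F -> cocycle_on is_rational p F h ->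
  (forall x, x <> 0 -> Rabs x < 1 -> lim_on (fun _ => True) h x (h x)) ->
  cocycle_on (fun _ => True) p F h.
Proof.
  intros HF HC Hh x _ Hx0 Hx; destruct (classic (is_rational x)) as [Rx|Nx]; [auto|].
  apply (lim_on_unique is_rational F x); [apply rational_cluster|now apply HF|].
  apply (lim_on_near is_rational is_rational
           (fun y => h y + cpow (Rabs y) p * F (- / y)%R)%C F).
  - eapply near_impl;
      [|apply (near_and _ _ _ (near_nonzero x Hx0) (near_Rabs_lt x 1 Hx))].
    intros y [Ny Hy] Ry; split; auto; symmetry; auto.
  - apply lim_on_plus; [apply (lim_on_sub (fun _ => True)); auto|].
    apply lim_on_mult; [now apply lim_cpow_abs|].
    apply (lim_on_comp is_rational is_rational F (fun y => - / y) x (- / x)); auto.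
    + apply HF; now apply irrational_opp_inv.
    + now apply continuity_pt_opp_inv.
    + exists 1; split; [lra|]; intros; now apply is_rational_opp_inv.
Qed.

(* The side [s = 1] is the right, [s = -1] the left. *)
Definition side (s x y : R) : Prop := 0 < s * (y - x).

(** At [0] the jump is [h0 - F 0], with weight 1. An inversion at [a/b] multiplies the jump by
    [|a/b|^p] and so turns the weight [|a|^(-p)] into [b^(-p)]. The side is preserved because [-1/x]
    is increasing on either side of [0]. *)
Lemma cocycle_one_sided_limit p F h s h0 M :
  0 < Re p -> periodic_on (fun _ => True) F -> cocycle_on (fun _ => True) p F h ->
  (forall x, x <> 0 -> Rabs x < 1 -> lim_on (fun _ => True) h x (h x)) ->
  lim_on (side s 0) h 0 h0 -> (forall x, Cmod (F x) <= M) ->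
  forall a b, (0 < b)%Z -> Z.gcd a b = 1%Z ->
  lim_on (side s (IZR a / IZR b)) F (IZR a / IZR b)
    (F (IZR a / IZR b)%R + cpow (IZR b) (- p) * (h0 - F 0))%C.
Proof.
  intros Hp HT HF Hh Hh0 HM; apply coprime_ind.
  - replace (0 / 1) with 0 by field.
    rewrite cpow_1_l; replace (F 0 + 1 * (h0 - F 0))%C with (h0 + 0)%C by ring.
    apply (lim_on_near (side s 0) (side s 0) (fun y => h y + pw 0 p y * F (- / y)%R)%C F).
    + eapply near_impl; [|apply (near_Rabs_lt 0 1); rewrite Rabs_R0; lra].
      intros y Hy Sy; split; auto; symmetry; rewrite pw_0; apply HF; auto.
      intros ->; unfold side in Sy; rewrite Rminus_0_r, Rmult_0_r in Sy; lra.
    + apply lim_on_plus; auto.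
      apply (lim_on_null_mult_bounded _ _ _ _ M).
      * apply (lim_on_sub (fun y => y <> 0)); [|apply lim_pw_0; simpl; lra].
        intros y Sy ->; unfold side in Sy; rewrite Rminus_0_r, Rmult_0_r in Sy; lra.
      * exists 1; split; [lra|]; auto.
  - intros a b n Hb H.
    assert (Hb' : 0 < IZR b) by (apply (IZR_lt 0); auto).
    replace (IZR (a + n * b) / IZR b) with (IZR a / IZR b + IZR n)
      by (rewrite plus_IZR, mult_IZR; field; lra).
    rewrite HT by auto; set (x := IZR a / IZR b) in *.
    intros e He; destruct (H e He) as (d & Hd & K); exists d; split; auto.
    intros y Sy Hy; rewrite <- (HT y (- n)%Z) by auto; rewrite opp_IZR; apply K.
    + unfold side in *; now replace (y + - IZR n - x) with (y - (x + IZR n)) by ring.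
    + now replace (y + - IZR n - x) with (y - (x + IZR n)) by ring.
  - intros a b Hb Ha Hab H; rewrite opp_inv_frac in H by auto.
    assert (Hb' : 0 < IZR b) by (apply (IZR_lt 0); auto).
    assert (Ha' : 0 < Rabs (IZR a)) by (apply Rabs_pos_lt; now apply not_0_IZR).
    assert (HxE : Rabs (IZR a / IZR b) = Rabs (IZR a) / IZR b)
      by (rewrite Rabs_div, (Rabs_pos_eq (IZR b)); lra).
    set (x := IZR a / IZR b) in *.
    assert (Hx0 : x <> 0).
    { intros E; rewrite E, Rabs_R0 in HxE.
      pose proof (Rdiv_lt_0_compat _ _ Ha' Hb'); lra. }
    assert (Hx : Rabs x < 1).
    { rewrite HxE, <- abs_IZR; apply Rmult_lt_reg_r with (IZR b); auto.
      unfold Rdiv; rewrite Rmult_assoc, Rinv_l by lra.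
      apply IZR_le in Hab; rewrite mult_IZR in Hab; lra. }
    assert (E : (cpow (Rabs x) p * cpow (IZR (Z.abs a)) (- p))%C = cpow (IZR b) (- p)).
    { rewrite abs_IZR.
      replace (Rabs (IZR a)) with (Rabs x * IZR b) by (rewrite HxE; field; lra).
      rewrite cpow_mult_base by (auto; now apply Rabs_pos_lt).
      pose proof (cpow_opp_cancel (Rabs x) p) as E'.
      transitivity ((cpow (Rabs x) (- p) * cpow (Rabs x) p) * cpow (IZR b) (- p))%C; [ring|].
      rewrite E'; ring. }
    replace (F x + cpow (IZR b) (- p) * (h0 - F 0))%C with
      (h x + cpow (Rabs x) p * (F (- / x)%R + cpow (IZR (Z.abs a)) (- p) * (h0 - F 0)))%C.
    2: { rewrite (HF x), <- E by auto; ring. }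
    apply (lim_on_near (side s x) (side s x)
             (fun y => h y + cpow (Rabs y) p * F (- / y)%R)%C F).
    { eapply near_impl;
        [|apply (near_and _ _ _ (near_nonzero x Hx0) (near_Rabs_lt x 1 Hx))].
      intros y [Ny Hy] Sy; split; auto; symmetry; auto. }
    apply lim_on_plus; [apply (lim_on_sub (fun _ => True)); auto|].
    apply lim_on_mult; [now apply lim_cpow_abs|].
    apply (lim_on_comp (side s x) (side s (- / x)) F (fun y => - / y) x (- / x)); auto.
    + now apply continuity_pt_opp_inv.
    + eapply near_impl; [|apply (near_neq0 x Hx0)]; intros y Hxy Sy; unfold side in *.
      assert (y <> 0) by (intros ->; lra).
      (* Near [x] the product [x * y] is positive, so the sign of [y - x] survives the inversion. *)
      replace (s * (- / y - - / x)) with (s * (y - x) * / (x * y)) by (field; auto).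
      apply Rmult_lt_0_compat; auto; now apply Rinv_0_lt_compat.
Qed.

(** * Differentiability *)

Lemma continuous_periodic_bounded F :
  periodic_on (fun _ => True) F -> (forall x, lim_on (fun _ => True) F x (F x)) ->
  exists M, 0 <= M /\ forall x, Cmod (F x) <= M.
Proof.
  intros HT Hc.
  destruct (locally_bounded_bounded (fun _ => True) F (- (1 / 2)) (1 / 2)) as [M HM].
  { intros x _; exists (Cmod (F x) + 1); apply lim_on_bounded, Hc. }
  assert (K : forall x, Cmod (F x) <= M).
  { intros x; destruct (nearest_int x) as [n Hn]; rewrite <- (HT x n) by auto.
    apply HM; auto; apply Rabs_le_between in Hn; lra. }
  exists M; split; auto; eapply Rle_trans; [apply Cmod_ge_0|apply (K 0)].
Qed.

Lemma Rabs_between y z c :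
  0 < y * z -> Rabs z <= Rabs y -> Rmin z y <= c <= Rmax z y -> c <> 0 /\ 0 < Rabs c <= Rabs y.
Proof.
  intros H1 H2 H3.
  assert (H4 : c <> 0 /\ Rabs c <= Rabs y).
  { revert H1 H2 H3; unfold Rmin, Rmax, Rabs.
    destruct (Rle_dec z y), (Rcase_abs y), (Rcase_abs z), (Rcase_abs c); intros;
      split; try lra; try (intros ->); nra. }
  split; [apply H4|split; [apply Rabs_pos_lt|]; apply H4].
Qed.

(** Equal signs keep the segment away from [0]; as [Re p >= 1], the derivative is largest in modulus
    where [|c|] is, so the farther point [y] gives the bound. *)
Lemma cpow_abs_mean_value p y z :
  1 <= Re p -> 0 < y * z -> Rabs z <= Rabs y ->
  Cmod (cpow (Rabs y) p - cpow (Rabs z) p)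
    <= 2 * (Cmod p * Rpower (Rabs y) (Re p - 1)) * Rabs (y - z).
Proof.
  intros Hp H1 H2.
  apply Cmod_mean_value with (f := fun x => cpow (Rabs x) p)
    (f' := fun x => (p * (cpow (Rabs x) p * RtoC (/ x)))%C).
  intros c Hc; destruct (Rabs_between y z c H1 H2 Hc) as (Nc & Hc').
  split; [now apply der_cpow_abs|].
  replace (cpow (Rabs c) p * RtoC (/ c))%C with (pw 1 p c) by (rewrite pw_S, pw_0; auto).
  rewrite Cmod_mult, Cmod_pw by auto.
  apply Rmult_le_compat_l; [apply Cmod_ge_0|]; apply Rpower_le_base; simpl; lra.
Qed.

Lemma Rpower_split t a : 0 < t -> Rpower t a = t * Rpower t (a - 1).
Proof.
  intros Ht; replace a with (1 + (a - 1)) at 1 by ring.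
  rewrite Rpower_plus, Rpower_1; auto.
Qed.

(** Let [y] tend to [0] in the equation: [F (- / y)] is bounded, so the power term vanishes. *)
Lemma cocycle_at_0 p F H :
  0 < Re p -> periodic_on (fun _ => True) F -> cocycle_on (fun _ => True) p F H ->
  (forall x, lim_on (fun _ => True) F x (F x)) ->
  lim_on (fun _ => True) H 0 (H 0) -> F 0 = H 0.
Proof.
  intros Hp HT HF Fc Hc.
  destruct (continuous_periodic_bounded F HT Fc) as (M & _ & HM).
  apply (lim_on_unique (fun y => y <> 0) F 0).
  - intros d Hd; exists (d / 2); split; [lra|]; rewrite Rminus_0_r, Rabs_pos_eq; lra.
  - apply (lim_on_sub (fun _ => True)); auto.
  - replace (H 0) with (H 0 + 0)%C by ring.
    apply (lim_on_near (fun y => y <> 0) (fun y => y <> 0)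
             (fun y => H y + pw 0 p y * F (- / y)%R)%C F).
    + eapply near_impl; [|apply (near_Rabs_lt 0 1); rewrite Rabs_R0; lra].
      intros y Hy Ny; split; auto; symmetry; rewrite pw_0; apply HF; auto.
    + apply lim_on_plus; [apply (lim_on_sub (fun _ => True)); auto|].
      apply (lim_on_null_mult_bounded _ _ _ _ M); [apply lim_pw_0; simpl; lra|].
      exists 1; split; [lra|]; auto.
Qed.

(** One estimate with two uses: [l = 0] with fixed [r] for the Lipschitz bound, and [l = H' 0] with
    small [r] for the slope at [0]. The bound [L] is required only of the inverted pair at hand, so
    that an induction on pairs can supply it. *)
Lemma cocycle_slope_around_0 p F H M r a L l :
  2 < Re p -> cocycle_on (fun _ => True) p F H -> F 0 = H 0 ->
  0 <= M -> (forall x, Cmod (F x) <= M) -> 0 < r < 1 -> 0 <= L ->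
  (forall y z, Rabs y <= r -> Rabs z <= r ->
     Cmod (H y - H z - l * RtoC (y - z)) <= a * Rabs (y - z)) ->
  forall y z, Rabs y <= r -> Rabs z <= r ->
  (0 < y * z -> Cmod (F (- / y) - F (- / z)) <= L * Rabs (- / y - - / z)) ->
  Cmod (F y - F z - l * RtoC (y - z))
    <= (a + (2 * Cmod p + 1) * M * Rpower r (Re p - 1) + L * Rpower r (Re p - 2))
       * Rabs (y - z).
Proof.
  intros Hp HF HF0 HM FM Hr HL HH.
  set (s := Re p) in *.
  set (b1 := Rpower r (s - 1)); set (b2 := Rpower r (s - 2)).
  assert (Hb1 : 0 < b1) by apply Rpower_pos; assert (Hb2 : 0 < b2) by apply Rpower_pos.
  pose proof (Cmod_ge_0 p) as Hp0.
  assert (N1 : 0 <= M * b1) by (apply Rmult_le_pos; lra).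
  assert (N2 : 0 <= Cmod p * (M * b1)) by (apply Rmult_le_pos; lra).
  assert (N3 : 0 <= L * b2) by (apply Rmult_le_pos; lra).
  assert (one : forall y, Rabs y <= r ->
    Cmod (F y - F 0 - l * RtoC y) <= (a + M * b1) * Rabs y).
  { intros y Hy; destruct (Req_dec y 0) as [->|Ny].
    - rewrite Rabs_R0; replace (F 0 - F 0 - l * RtoC 0)%C with (RtoC 0) by ring.
      rewrite Cmod_0; lra.
    - pose proof (Rabs_pos_lt y Ny) as Py.
      rewrite (HF y), HF0 by (auto; lra).
      replace (H y + cpow (Rabs y) p * F (- / y)%R - H 0 - l * RtoC y)%C with
        ((H y - H 0 - l * RtoC (y - 0)) + cpow (Rabs y) p * F (- / y)%R)%C
        by (rewrite Rminus_0_r; ring).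
      eapply Rle_trans; [apply Cmod_triangle|]; rewrite Cmod_mult, Cmod_cpow; fold s.
      specialize (HH y 0 Hy ltac:(rewrite Rabs_R0; lra)).
      rewrite Rminus_0_r in *; rewrite (Rpower_split _ s) by auto.
      assert (Rpower (Rabs y) (s - 1) <= b1) by (apply Rpower_le_base; lra).
      assert (Rabs y * Rpower (Rabs y) (s - 1) * Cmod (F (- / y)) <= Rabs y * b1 * M); [|lra].
      apply Rmult_le_compat; auto; [|apply Cmod_ge_0|].
      + apply Rmult_le_pos; [lra|left; apply Rpower_pos].
      + apply Rmult_le_compat_l; lra. }
  assert (two : forall y z, Rabs y <= r -> 0 < y * z -> Rabs z <= Rabs y ->
    Cmod (F (- / y) - F (- / z)) <= L * Rabs (- / y - - / z) ->
    Cmod (F y - F z - l * RtoC (y - z)) <= (a + 2 * Cmod p * M * b1 + L * b2) * Rabs (y - z)).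
  { intros y z Hy Hyz Hzy HFL.
    assert (Ny : y <> 0) by (intros ->; lra); assert (Nz : z <> 0) by (intros ->; lra).
    pose proof (Rabs_pos_lt y Ny) as Py; pose proof (Rabs_pos_lt z Nz) as Pz.
    rewrite (HF y), (HF z) by (auto; lra).
    replace (H y + cpow (Rabs y) p * F (- / y)%R - (H z + cpow (Rabs z) p * F (- / z)%R)
               - l * RtoC (y - z))%C with
      ((H y - H z - l * RtoC (y - z)) +
       ((cpow (Rabs y) p - cpow (Rabs z) p) * F (- / y)%R
        + cpow (Rabs z) p * (F (- / y)%R - F (- / z)%R)))%C by ring.
    eapply Rle_trans; [apply Cmod_triangle|].
    eapply Rle_trans; [apply Rplus_le_compat_l, Cmod_triangle|].
    rewrite !Cmod_mult, Cmod_cpow; fold s.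
    specialize (HH y z Hy ltac:(lra)).
    pose proof (cpow_abs_mean_value p y z ltac:(fold s; lra) Hyz Hzy) as HP; fold s in HP.
    set (t := Rabs (y - z)) in *; assert (Ht : 0 <= t) by apply Rabs_pos.
    assert (E1 : Rpower (Rabs y) (s - 1) <= b1) by (apply Rpower_le_base; lra).
    assert (E2 : Rpower (Rabs z) (s - 2) <= b2) by (apply Rpower_le_base; lra).
    assert (E3 : Rabs (- / y - - / z) = t / (Rabs y * Rabs z)).
    { replace (- / y - - / z) with ((y - z) / (y * z)) by (field; auto).
      rewrite Rabs_div, Rabs_mult by nra; reflexivity. }
    rewrite E3 in HFL.
    assert (E4 : Cmod (cpow (Rabs y) p - cpow (Rabs z) p) * Cmod (F (- / y))
                 <= 2 * (Cmod p * b1) * t * M).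
    { apply Rmult_le_compat; auto; try apply Cmod_ge_0.
      eapply Rle_trans; [exact HP|]; apply Rmult_le_compat_r; auto.
      apply Rmult_le_compat_l; [lra|]; apply Rmult_le_compat_l; lra. }
    (* Inversion divides the distance by [|y| |z|]. The weight [|z|^s] belongs to the smaller
       modulus: one factor [|z|] cancels, a second is at most [|y|], and [|z|^(s - 2)] remains. *)
    assert (E5 : Rpower (Rabs z) s * Cmod (F (- / y) - F (- / z)) <= L * b2 * t).
    { rewrite (Rpower_split _ s), (Rpower_split _ (s - 1)) by auto.
      replace (s - 1 - 1) with (s - 2) by ring.
      apply Rle_trans with (Rabs z * (Rabs z * b2) * (L * (t / (Rabs y * Rabs z)))).
      - apply Rmult_le_compat; auto; try apply Cmod_ge_0.
        + repeat apply Rmult_le_pos; try lra; left; apply Rpower_pos.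
        + repeat (apply Rmult_le_compat_l; [lra|]); auto.
      - apply Rle_trans with (L * b2 * t * (Rabs z / Rabs y)).
        + right; field; split; lra.
        + rewrite <- (Rmult_1_r (L * b2 * t)) at 2.
          apply Rmult_le_compat_l; [now apply Rmult_le_pos|].
          apply Rmult_le_reg_r with (Rabs y); auto; unfold Rdiv.
          rewrite Rmult_assoc, Rinv_l by lra; lra. }
    lra. }
  intros y z Hy Hz HFL.
  assert (Hc : a + 2 * Cmod p * M * b1 + L * b2 <=
               a + (2 * Cmod p + 1) * M * b1 + L * b2) by lra.
  assert (Hc' : a + M * b1 <= a + (2 * Cmod p + 1) * M * b1 + L * b2) by lra.
  set (c := a + (2 * Cmod p + 1) * M * b1 + L * b2) in *.
  destruct (Rlt_le_dec 0 (y * z)) as [Hyz|Hyz].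
  - eapply Rle_trans; [|apply Rmult_le_compat_r; [apply Rabs_pos|exact Hc]].
    destruct (Rle_dec (Rabs z) (Rabs y)) as [Hzy|Hzy]; [apply two; auto|].
    rewrite <- Cmod_opp, (Rabs_minus_sym y z).
    replace (- (F y - F z - l * RtoC (y - z)))%C with (F z - F y - l * RtoC (z - y))%C
      by (rewrite !RtoC_minus; ring).
    apply two; auto; try lra.
    rewrite Cmod_minus_sym, Rabs_minus_sym; auto.
  (* For opposite signs the comparison goes through [0] without loss, since then
     [|y - z| = |y| + |z|]. *)
  - replace (F y - F z - l * RtoC (y - z))%C with
      ((F y - F 0 - l * RtoC y) - (F z - F 0 - l * RtoC z))%C by (rewrite RtoC_minus; ring).
    eapply Rle_trans; [apply Cmod_triangle|]; rewrite Cmod_opp.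
    eapply Rle_trans; [apply Rplus_le_compat; apply one; auto|].
    rewrite <- Rmult_plus_distr_l.
    replace (Rabs (y - z)) with (Rabs y + Rabs z).
    + apply Rmult_le_compat_r; auto; pose proof (Rabs_pos y); pose proof (Rabs_pos z); lra.
    + unfold Rabs; destruct (Rcase_abs y), (Rcase_abs z), (Rcase_abs (y - z)); nra.
Qed.

(* Each application of [x |-> -1/x] stretches small distances by at least 16/9, so
   finitely many of them reduce to points at distance at least 1/4. *)
Lemma cocycle_lipschitz p F H H' :
  2 < Re p -> periodic_on (fun _ => True) F -> cocycle_on (fun _ => True) p F H ->
  (forall x, lim_on (fun _ => True) F x (F x)) ->
  (forall x, Rabs x < 1 -> der H x (H' x)) ->
  (forall x, Rabs x < 1 -> lim_on (fun _ => True) H' x (H' x)) ->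
  exists L, 0 <= L /\ forall y z, Cmod (F y - F z) <= L * Rabs (y - z).
Proof.
  intros Hp HT HF Fc HH HH'.
  destruct (continuous_periodic_bounded F HT Fc) as (M & HM & FM).
  assert (HF0 : F 0 = H 0).
  { apply (cocycle_at_0 p F H); auto; [lra|].
    apply der_lim with (l := H' 0), HH; rewrite Rabs_R0; lra. }
  destruct (locally_bounded_bounded (fun _ => True) H' (- (3 / 4)) (3 / 4)) as [a Ha].
  { intros x Hx; exists (Cmod (H' x) + 1); apply lim_on_bounded, HH'.
    apply Rabs_def1; lra. }
  assert (HL : forall y z, Rabs y <= 3 / 4 -> Rabs z <= 3 / 4 ->
     Cmod (H y - H z - 0 * RtoC (y - z)) <= 2 * a * Rabs (y - z)).
  { intros y z Hy Hz; replace (H y - H z - 0 * RtoC (y - z))%C with (H y - H z)%C by ring.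
    apply Cmod_mean_value with (f' := H'); intros c Hc.
    apply Rabs_le_between in Hy; apply Rabs_le_between in Hz.
    unfold Rmin, Rmax in Hc.
    assert (- (3 / 4) <= c <= 3 / 4) by (destruct (Rle_dec z y); lra).
    split; [apply HH, Rabs_def1; lra|apply Ha; auto]. }
  set (q := Rpower (3 / 4) (Re p - 2)).
  assert (Hq : 0 < q < 1) by (split; [apply Rpower_pos|apply Rpower_lt_1; lra]).
  set (b := Rpower (3 / 4) (Re p - 1)).
  set (c := 2 * a + (2 * Cmod p + 1) * M * b).
  (* With [8 * M], pairs at distance at least [1/4] satisfy the bound because [F] varies by at most
     [2 * M]; with [c / (1 - q)], an inversion reproduces the same [L]. *)
  set (L := Rmax (8 * M) (c / (1 - q))).
  assert (HL8 : 8 * M <= L) by apply Rmax_l.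
  assert (HLc : c + L * q <= L).
  { assert (c <= (1 - q) * L); [|lra].
    apply Rle_trans with ((1 - q) * (c / (1 - q))); [right; field; lra|].
    apply Rmult_le_compat_l; [lra|apply Rmax_r]. }
  assert (K : forall n y z, 1 / 4 * (9 / 16) ^ n <= Rabs (y - z) ->
                Cmod (F y - F z) <= L * Rabs (y - z)).
  { assert (far : forall y z, 1 / 4 <= Rabs (y - z) -> Cmod (F y - F z) <= L * Rabs (y - z)).
    { intros y z Hd.
      apply Rle_trans with (2 * M); [|apply Rle_trans with (8 * M * (1 / 4)); [lra|]].
      - eapply Rle_trans; [apply Cmod_triangle|]; rewrite Cmod_opp.
        pose proof (FM y); pose proof (FM z); lra.
      - apply Rmult_le_compat; lra. }
    induction n as [|n IH]; intros y z Hd; [apply far; simpl in Hd; lra|].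
    destruct (Rle_dec (1 / 4) (Rabs (y - z))) as [Hf|Hf]; [now apply far|].
    destruct (nearest_int y) as [m Hm].
    rewrite <- (HT y m), <- (HT z m) by auto.
    replace (y - z) with ((y + IZR m) - (z + IZR m)) in * by ring.
    set (u := y + IZR m) in *; set (v := z + IZR m) in *.
    (* Both points are moved by the same integer, the one that brings [y] within [1/2] of [0]; the
       other follows within [1/4]. Hence [3/4], and its square [9/16] for the growth of
       distances. *)
    assert (Hu : Rabs u <= 3 / 4) by lra.
    assert (Hv : Rabs v <= 3 / 4).
    { replace v with (u - (u - v)) by ring.
      eapply Rle_trans; [apply Rabs_triang|]; rewrite Rabs_Ropp; lra. }
    replace (F u - F v)%C with (F u - F v - 0 * RtoC (u - v))%C by ring.
    eapply Rle_trans; [apply (cocycle_slope_around_0 p F H M (3 / 4) (2 * a) L 0); auto; try lra|].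
    - intros Huv; apply IH.
      assert (Nu : u <> 0) by (intros E; rewrite E in Huv; lra).
      assert (Nv : v <> 0) by (intros E; rewrite E in Huv; lra).
      replace (- / u - - / v) with ((u - v) / (u * v)) by (field; auto).
      rewrite Rabs_div, Rabs_mult by nra.
      pose proof (Rabs_pos_lt u Nu); pose proof (Rabs_pos_lt v Nv).
      assert (0 < Rabs u * Rabs v) by now apply Rmult_lt_0_compat.
      assert (Rabs u * Rabs v <= 9 / 16) by nra.
      apply Rmult_le_reg_r with (Rabs u * Rabs v); auto.
      apply Rle_trans with (Rabs (u - v)); [|right; field; split; lra].
      simpl in Hd; pose proof (pow_lt (9 / 16) n ltac:(lra)); nra.
    - apply Rmult_le_compat_r; [apply Rabs_pos|]; fold q b; unfold c in HLc; lra. }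
  exists L; split; [lra|]; intros y z.
  destruct (Req_dec y z) as [->|Nyz].
  - replace (F z - F z)%C with (RtoC 0) by ring; rewrite Cmod_0.
    apply Rmult_le_pos; [lra|apply Rabs_pos].
  - assert (Hd : 0 < Rabs (y - z)) by (apply Rabs_pos_lt; lra).
    destruct (pow_lt_1_zero (9 / 16)) with (y := Rabs (y - z)) as [N HN]; auto.
    + rewrite Rabs_pos_eq; lra.
    + apply (K N); specialize (HN N (le_n N)).
      pose proof (pow_lt (9 / 16) N ltac:(lra)); rewrite Rabs_pos_eq in HN; lra.
Qed.

Lemma approx_slope_le_lip F x L :
  (forall y z, Cmod (F y - F z) <= L * Rabs (y - z)) -> approx_slope F x 0%C L.
Proof.
  intros H; exists 1; split; [lra|]; intros y z _ _.
  replace (F y - F z - 0 * RtoC (y - z))%C with (F y - F z)%C by ring; auto.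
Qed.

Lemma approx_slope_dist F x l w l' w' :
  approx_slope F x l w -> approx_slope F x l' w' -> Cmod (l - l') <= w + w'.
Proof.
  intros (d1 & H1 & K1) (d2 & H2 & K2).
  set (t := Rmin d1 d2 / 2).
  assert (Ht : 0 < t < d1 /\ t < d2).
  { unfold t; pose proof (Rmin_pos d1 d2 H1 H2).
    pose proof (Rmin_l d1 d2); pose proof (Rmin_r d1 d2); lra. }
  specialize (K1 (x + t) x); specialize (K2 (x + t) x).
  replace (x + t - x) with t in * by ring; replace (x - x) with 0 in * by ring.
  rewrite Rabs_R0, (Rabs_pos_eq t) in * by lra.
  specialize (K1 ltac:(lra) ltac:(lra)); specialize (K2 ltac:(lra) ltac:(lra)).
  apply Rmult_le_reg_r with t; [lra|].
  rewrite <- (Rabs_pos_eq t) at 1 by lra; rewrite <- Cmod_R, <- Cmod_mult.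
  replace ((l - l') * RtoC t)%C with
    ((F (x + t)%R - F x - l' * RtoC t) - (F (x + t)%R - F x - l * RtoC t))%C by ring.
  eapply Rle_trans; [apply Cmod_triangle|]; rewrite Cmod_opp; lra.
Qed.

(** By the Lipschitz bound, slope [0] is correct up to [L] at every point, and contraction improves
    this. At [0], where no inversion is possible, the slope is [H' 0] outright. *)
Lemma cocycle_strict_der p F H H' :
  2 < Re p -> periodic_on (fun _ => True) F -> cocycle_on (fun _ => True) p F H ->
  (forall x, lim_on (fun _ => True) F x (F x)) ->
  (forall x, Rabs x < 1 -> der H x (H' x)) ->
  (forall x, Rabs x < 1 -> lim_on (fun _ => True) H' x (H' x)) ->
  forall x, exists l, strict_der F x l.
Proof.
  intros Hp HT HF Fc HH HH' x.
  destruct (continuous_periodic_bounded F HT Fc) as (M & HM & FM).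
  destruct (cocycle_lipschitz p F H H') as (L & HL & FL); auto.
  assert (HF0 : F 0 = H 0).
  { apply (cocycle_at_0 p F H); auto; [lra|].
    apply der_lim with (l := H' 0), HH; rewrite Rabs_R0; lra. }
  assert (Hs : forall y, Rabs y < 1 -> strict_der H y (H' y)).
  { intros y Hy; apply C1_strict_der; auto.
    eapply near_impl; [|apply (near_Rabs_lt y 1 Hy)]; auto. }
  set (q := Rpower (1 / 2) (Re p - 2)).
  assert (Hq : 0 < q < 1) by (split; [apply Rpower_pos|apply Rpower_lt_1; lra]).
  (* On [[-r, r]] the two remainders carry [r^(Re p - 1)] and [r^(Re p - 2)], both small with [r]
     because [Re p > 2]; [c] below gathers their coefficients. *)
  assert (at0 : forall e, 0 < e -> approx_slope F 0 (H' 0) e).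
  { intros e He.
    set (c := (2 * Cmod p + 1) * M + L + 1).
    assert (N1 : 0 <= (2 * Cmod p + 1) * M).
    { apply Rmult_le_pos; auto; pose proof (Cmod_ge_0 p); lra. }
    assert (Hc : 0 < c) by (unfold c; lra).
    destruct (Hs 0 ltac:(rewrite Rabs_R0; lra) (e / 2)) as (d0 & Hd0 & K0); [lra|].
    destruct (Rpower_small (Re p - 1) (e / (2 * c))) as (d1 & Hd1 & K1);
      [lra|apply Rdiv_lt_0_compat; lra|].
    destruct (Rpower_small (Re p - 2) (e / (2 * c))) as (d2 & Hd2 & K2);
      [lra|apply Rdiv_lt_0_compat; lra|].
    set (r := Rmin (Rmin d0 d1) (Rmin d2 1) / 2).
    assert (Hr : 0 < r < d0 /\ r < d1 /\ r < d2 /\ r < 1).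
    { unfold r; pose proof (Rmin_pos _ _ (Rmin_pos _ _ Hd0 Hd1) (Rmin_pos _ _ Hd2 Rlt_0_1)).
      pose proof (Rmin_l (Rmin d0 d1) (Rmin d2 1)); pose proof (Rmin_r (Rmin d0 d1) (Rmin d2 1)).
      pose proof (Rmin_l d0 d1); pose proof (Rmin_r d0 d1).
      pose proof (Rmin_l d2 1); pose proof (Rmin_r d2 1); lra. }
    exists r; split; [lra|]; intros y z Hy Hz; rewrite Rminus_0_r in *.
    eapply Rle_trans.
    - apply (cocycle_slope_around_0 p F H M r (e / 2) L (H' 0)); auto; try lra.
      intros u v Hu Hv; apply K0; rewrite Rminus_0_r; lra.
    - apply Rmult_le_compat_r; [apply Rabs_pos|].
      specialize (K1 r ltac:(lra)); specialize (K2 r ltac:(lra)).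
      assert ((2 * Cmod p + 1) * M * Rpower r (Re p - 1)
                <= (2 * Cmod p + 1) * M * (e / (2 * c))) by (apply Rmult_le_compat_l; lra).
      assert (L * Rpower r (Re p - 2) <= L * (e / (2 * c))) by (apply Rmult_le_compat_l; lra).
      assert (c * (e / (2 * c)) = e / 2) by (field; lra).
      assert (0 < e / (2 * c)) by (apply Rdiv_lt_0_compat; lra).
      unfold c in *; lra. }
  assert (osc : forall x e, True -> 0 < e -> exists w, 0 <= w < e /\
                  forall e', 0 < e' -> exists l, approx_slope F x l (w + e')).
  { clear x.
    apply (oscillation_vanishes (fun _ => True)
             (fun x w => forall e', 0 < e' -> exists l, approx_slope F x l (w + e')) L q);
      auto; try lra.
    - intros x _ e He; exists 0%C.
      apply (approx_slope_le _ _ _ L); [lra|now apply approx_slope_le_lip].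
    - intros x n w _ W e He; destruct (W e He) as (l & d & Hd & K).
      exists l, d; split; auto; intros y z Hy Hz.
      rewrite <- (HT y n), <- (HT z n) by auto.
      replace (y - z) with ((y + IZR n) - (z + IZR n)) by ring.
      apply K; [replace (y + IZR n - (x + IZR n)) with (y - x) by ring
               |replace (z + IZR n - (x + IZR n)) with (z - x) by ring]; auto.
    - intros x w _ Hx Hw W e He; destruct (Req_dec x 0) as [->|Nx].
      + exists (H' 0); apply (approx_slope_le _ _ _ e); [|auto].
        assert (0 <= q * w) by (apply Rmult_le_pos; lra); lra.
      + destruct (W Nx (e / 4)) as [l' Hl']; [lra|].
        (* The slope is whatever the sum, product and chain rules produce; only its error is
           tracked. *)
        eexists.
        apply (approx_slope_ext (fun y => H y + cpow (Rabs y) p * F (- / y)%R)%C F).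
        { eapply near_impl;
            [|apply (near_and _ _ _ (near_nonzero x Nx) (near_Rabs_lt x 1 ltac:(lra)))].
          intros y [Ny Hy]; symmetry; auto. }
        eapply approx_slope_le;
          [|apply approx_slope_plus;
            [apply (Hs x ltac:(lra) (e / 4)); lra
            |apply (approx_slope_mult_comp (fun y => cpow (Rabs y) p) F (fun y => - / y) x
               _ _ _ (w + e / 4) (strict_der_cpow_abs p x Nx) (strict_der_opp_inv x Nx)
               ltac:(lra) Hl' (e / 4)); lra]].
        (* The derivative [x^(-2)] of the inversion reduces the weight to [|x|^(Re p - 2)], still at
           most [q] for [|x| <= 1/2]. *)
        assert (E : Cmod (cpow (Rabs x) p) * Rabs (/ (x * x)) <= q).
        { rewrite <- (Cmod_R (/ (x * x))), <- Cmod_mult.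
          replace (cpow (Rabs x) p * RtoC (/ (x * x)))%C with (pw 2 p x)
            by (rewrite !pw_S, pw_0, Rinv_mult, RtoC_mult; ring).
          rewrite Cmod_pw by auto; simpl; apply Rpower_le_base; [|lra].
          split; auto; now apply Rabs_pos_lt. }
        assert (Cmod (cpow (Rabs x) p) * Rabs (/ (x * x)) * (w + e / 4) <= q * (w + e / 4))
          by (apply Rmult_le_compat_r; lra).
        assert (q * (e / 4) <= e / 4) by nra.
        lra. }
  destruct (approx_complete (approx_slope F x)) as [l Hl].
  - intros e He; destruct (osc x (e / 2) I) as (w & Hw & K); [lra|].
    destruct (K (e - w)) as [l Hl]; [lra|]; exists l.
    replace (w + (e - w)) with e in Hl by ring; exact Hl.
  - intros; eapply approx_slope_dist; eauto.
  - exists l; intros e He; destruct (osc x (e / 4) I) as (w & Hw & K); [lra|].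
    destruct (K (e / 4 - w)) as [l' Hl']; [lra|].
    specialize (Hl _ _ Hl'); destruct Hl' as (d & Hd & Kd).
    exists d; split; auto; intros y z Hy Hz; specialize (Kd y z Hy Hz).
    replace (F y - F z - l * RtoC (y - z))%C with
      ((F y - F z - l' * RtoC (y - z)) + (l' - l) * RtoC (y - z))%C by ring.
    eapply Rle_trans; [apply Cmod_triangle|]; rewrite (Cmod_mult (l' - l)), Cmod_R.
    pose proof (Rabs_pos (y - z)).
    assert (Cmod (l' - l) * Rabs (y - z) <= 2 * (w + (e / 4 - w)) * Rabs (y - z))
      by (apply Rmult_le_compat_r; auto).
    nra.
Qed.

(** * Higher smoothness *)

Lemma Cm_on_0 (D : R -> Prop) g :
  (forall x, D x -> lim_on D g x (g x)) -> Cm_on D 0 g.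
Proof.
  intros H; exists (fun _ => g); split; [auto|split; [intros; lia|]].
  intros j x _ Dx; apply filterlim_lim_on; auto.
Qed.

Lemma Cm_on_continuous (D : R -> Prop) m g :
  Cm_on D m g -> forall x, D x -> lim_on D g x (g x).
Proof.
  intros (G & G0 & _ & Gc) x Dx; rewrite <- G0 by auto.
  apply (lim_on_near D D (G 0%nat) g).
  - exists 1; split; [lra|]; intros y _ Dy; split; auto.
  - apply filterlim_lim_on, Gc; auto; lia.
Qed.

Lemma Cm_on_S_inv (D : R -> Prop) m g :
  Cm_on D (S m) g ->
  exists g', (forall x, D x -> der_on D g x (g' x)) /\ Cm_on D m g'.
Proof.
  intros (G & G0 & Gd & Gc); exists (G 1%nat); split.
  - intros x Dx w Hw.
    assert (K : der_on D (G 0%nat) x (G 1%nat x)).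
    { apply quotient_der_on, Gd; auto; lia. }
    eapply near_impl; [|exact (K w Hw)]; intros y Hy Dy.
    rewrite <- !G0 by auto; auto.
  - exists (fun j => G (S j)); split; [auto|split].
    + intros j x Hj Dx; apply Gd; auto; lia.
    + intros j x Hj Dx; apply Gc; auto; lia.
Qed.

Lemma Cm_on_S_intro (D : R -> Prop) m g g' :
  (forall x, D x -> lim_on D g x (g x)) -> (forall x, D x -> der_on D g x (g' x)) ->
  Cm_on D m g' -> Cm_on D (S m) g.
Proof.
  intros Hc Hd (G & G0 & Gd & Gc).
  exists (fun j => match j with O => g | S i => G i end); split; [auto|split].
  - intros [|j] x Hj Dx.
    + apply quotient_der_on; rewrite G0 by auto; auto.
    + apply Gd; auto; lia.
  - intros [|j] x Hj Dx.
    + apply filterlim_lim_on; auto.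
    + apply Gc; auto; lia.
Qed.

Lemma Cm_on_pred (D : R -> Prop) m g : Cm_on D (S m) g -> Cm_on D m g.
Proof.
  intros (G & G0 & Gd & Gc); exists G; split; [auto|split].
  - intros; apply Gd; auto; lia.
  - intros; apply Gc; auto; lia.
Qed.

Lemma Cm_on_sub (D1 D2 : R -> Prop) m g :
  (forall x, D2 x -> D1 x) -> Cm_on D1 m g -> Cm_on D2 m g.
Proof.
  intros HD (G & G0 & Gd & Gc); exists G; split; [auto|split].
  - intros j x Hj Dx; apply quotient_der_on, (der_on_sub D1); auto.
    apply quotient_der_on; auto.
  - intros j x Hj Dx; apply filterlim_lim_on, (lim_on_sub D1); auto.
    apply filterlim_lim_on; auto.
Qed.

Lemma der_on_plus_scal (D : R -> Prop) f g x a b c :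
  der_on D f x a -> der_on D g x b ->
  der_on D (fun y => f y + c * g y)%C x (a + c * b)%C.
Proof.
  intros Hf Hg w Hw; pose proof (Cmod_ge_0 c) as Hc.
  set (v := w / 2 / (Cmod c + 1)).
  assert (Hv : 0 < v) by (apply Rdiv_lt_0_compat; lra).
  eapply near_impl; [|apply (near_and _ _ _ (Hf (w / 2) ltac:(lra)) (Hg v Hv))].
  intros y [K1 K2] Dy; specialize (K1 Dy); specialize (K2 Dy).
  replace (f y + c * g y - (f x + c * g x) - (a + c * b) * RtoC (y - x))%C with
    ((f y - f x - a * RtoC (y - x)) + c * (g y - g x - b * RtoC (y - x)))%C by ring.
  eapply Rle_trans; [apply Cmod_triangle|]; rewrite (Cmod_mult c).
  pose proof (Rabs_pos (y - x)).
  assert (Cmod c * Cmod (g y - g x - b * RtoC (y - x)) <= (Cmod c + 1) * (v * Rabs (y - x))).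
  { apply Rmult_le_compat; auto; try apply Cmod_ge_0; lra. }
  assert ((Cmod c + 1) * (v * Rabs (y - x)) = w / 2 * Rabs (y - x)) by (unfold v; field; lra).
  lra.
Qed.

Lemma Cm_on_plus_scal (D : R -> Prop) m f g c :
  Cm_on D m f -> Cm_on D m g -> Cm_on D m (fun x => f x + c * g x)%C.
Proof.
  intros (F & F0 & Fd & Fc) (G & G0 & Gd & Gc).
  exists (fun j x => F j x + c * G j x)%C; split; [|split].
  - intros x Dx; now rewrite F0, G0.
  - intros j x Hj Dx.
    apply (quotient_der_on D (fun x => F j x + c * G j x)%C), der_on_plus_scal;
      apply quotient_der_on; auto.
  - intros j x Hj Dx; apply filterlim_lim_on.
    apply lim_on_plus; [|apply lim_on_mult; [apply lim_on_const|]];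
      apply filterlim_lim_on; auto.
Qed.

Lemma der_periodic F F' :
  periodic_on (fun _ => True) F -> (forall x, der F x (F' x)) ->
  periodic_on (fun _ => True) F'.
Proof.
  intros HT HD x n _; apply (der_unique F x); auto.
  intros w Hw; apply near_impl with (2 := near_shift _ _ _ (HD (x + IZR n) w Hw)).
  intros y K _; specialize (K I); rewrite !HT in K by auto.
  now replace (y + IZR n - (x + IZR n)) with (y - x) in K by ring.
Qed.

(** The value [0] at [0] is the limit there when [j < Re p] and [F] is bounded, so this is the
    continuous extension. *)
Definition pw_inv (j : nat) (p : C) (F : R -> C) (x : R) : C :=
  if Req_EM_T x 0 then 0%C else (pw j p x * F (- / x)%R)%C.

Lemma pw_inv_neq j p F x : x <> 0 -> pw_inv j p F x = (pw j p x * F (- / x)%R)%C.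
Proof. intros H; unfold pw_inv; destruct (Req_EM_T x 0); tauto. Qed.

Lemma pw_inv_0 j p F : pw_inv j p F 0 = 0%C.
Proof. unfold pw_inv; destruct (Req_EM_T 0 0); tauto. Qed.

Lemma strict_der_pw_inv j p F l x :
  x <> 0 -> strict_der F (- / x) l ->
  strict_der (pw_inv j p F) x
    ((p - RtoC (INR j)) * pw (S j) p x * F (- / x)%R + pw (S (S j)) p x * l)%C.
Proof.
  intros Nx Hl.
  eapply strict_der_ext; [| |
    apply (strict_der_mult_comp (pw j p) F (fun y => - / y) x _ (/ (x * x)) l
             (strict_der_pw j p x Nx) (strict_der_opp_inv x Nx) Hl)].
  - eapply near_impl; [|exact (near_nonzero x Nx)]; intros y Ny.
    now rewrite pw_inv_neq.
  - rewrite !pw_S, Rinv_mult, RtoC_mult; ring.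
Qed.

Lemma pw_inv_continuous j p F :
  INR j < Re p -> periodic_on (fun _ => True) F ->
  (forall x, lim_on (fun _ => True) F x (F x)) ->
  forall x, lim_on (fun _ => True) (pw_inv j p F) x (pw_inv j p F x).
Proof.
  intros Hp HT Fc x.
  destruct (continuous_periodic_bounded F HT Fc) as (M & HM & FM).
  destruct (Req_dec x 0) as [->|Nx].
  - rewrite pw_inv_0; intros e He.
    destruct (lim_pw_0 j p Hp (e / (M + 1))) as (d & Hd & K); [apply Rdiv_lt_0_compat; lra|].
    exists d; split; auto; intros y _ Hy.
    destruct (Req_dec y 0) as [->|Ny].
    + rewrite pw_inv_0; replace (0 - 0)%C with (RtoC 0) by ring; now rewrite Cmod_0.
    + rewrite pw_inv_neq by auto; specialize (K y Ny Hy).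
      replace (pw j p y - 0)%C with (pw j p y) in K by ring.
      replace (pw j p y * F (- / y)%R - 0)%C with (pw j p y * F (- / y)%R)%C by ring.
      rewrite Cmod_mult.
      apply Rle_lt_trans with (Cmod (pw j p y) * (M + 1)).
      * apply Rmult_le_compat_l; [apply Cmod_ge_0|]; pose proof (FM (- / y)); lra.
      * apply Rlt_le_trans with (e / (M + 1) * (M + 1)); [apply Rmult_lt_compat_r; lra|].
        right; field; lra.
  - rewrite pw_inv_neq by auto.
    apply (lim_on_near (fun _ => True) (fun _ => True) (fun y => pw j p y * F (- / y)%R)%C).
    + eapply near_impl; [|exact (near_nonzero x Nx)]; intros y Ny _; split; auto.
      now rewrite pw_inv_neq.
    + apply lim_on_mult.
      * eapply der_lim, strict_der_der, strict_der_pw; auto.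
      * apply (lim_on_comp _ (fun _ => True) F (fun y => - / y) x (- / x)); auto.
        -- now apply continuity_pt_opp_inv.
        -- exists 1; split; [lra|auto].
Qed.

(** Division by [y] turns [pw j] into [pw (S j)], which still tends to [0]; boundedness of [F] does
    the rest. *)
Lemma der_pw_inv_0 j p F M :
  INR j + 1 < Re p -> 0 <= M -> (forall x, Cmod (F x) <= M) -> der (pw_inv j p F) 0 0%C.
Proof.
  intros Hp HM FM w Hw.
  destruct (lim_pw_0 (S j) p ltac:(rewrite S_INR; lra) (w / (M + 1))) as (d & Hd & K).
  { apply Rdiv_lt_0_compat; lra. }
  exists d; split; auto; intros y Hy _; rewrite pw_inv_0, Rminus_0_r in *.
  replace (pw_inv j p F y - 0 - 0 * RtoC y)%C with (pw_inv j p F y) by ring.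
  destruct (Req_dec y 0) as [->|Ny].
  - rewrite pw_inv_0, Cmod_0, Rabs_R0; lra.
  - specialize (K y Ny ltac:(now rewrite Rminus_0_r)).
    replace (pw (S j) p y - 0)%C with (pw (S j) p y) in K by ring.
    rewrite pw_inv_neq by auto.
    assert (NyC : RtoC y <> 0%C) by (intros E; now apply RtoC_inj in E).
    replace (pw j p y) with (pw (S j) p y * RtoC y)%C
      by (rewrite pw_S, RtoC_inv by auto; field; auto).
    rewrite !Cmod_mult, Cmod_R.
    apply Rle_trans with (w / (M + 1) * Rabs y * (M + 1)); [|right; field; lra].
    apply Rmult_le_compat; try apply Cmod_ge_0.
    + apply Rmult_le_pos; [apply Cmod_ge_0|apply Rabs_pos].
    + apply Rmult_le_compat_r; [apply Rabs_pos|lra].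
    + pose proof (FM (- / y)); lra.
Qed.

(** The family is closed under differentiation: the derivative combines [F'] at index [j + 2] with
    [F] at index [j + 1]. A derivative thus costs at most 2 in the index, which is the condition
    [INR j + 2 * INR n < Re p]. *)
Lemma Cm_on_pw_inv n : forall j p F,
  INR j + 2 * INR n < Re p -> periodic_on (fun _ => True) F ->
  Cm_on (fun _ => True) n F -> Cm_on (fun _ => True) n (pw_inv j p F).
Proof.
  induction n as [|n IH]; intros j p F Hp HT HF;
    assert (Fc := fun x => Cm_on_continuous _ _ _ HF x I).
  - apply Cm_on_0; intros x _; apply pw_inv_continuous; auto; simpl in Hp; lra.
  - rewrite S_INR in Hp; pose proof (pos_INR n); pose proof (pos_INR j).
    destruct (continuous_periodic_bounded F HT Fc) as (M & HM & FM).
    assert (HF1 := Cm_on_pred _ _ _ HF).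
    destruct (Cm_on_S_inv _ _ _ HF) as (F' & Fd & HF').
    assert (HT' : periodic_on (fun _ => True) F') by (apply (der_periodic F); auto).
    assert (Fs : forall x, strict_der F x (F' x)).
    { intros x; apply C1_strict_der; [exists 1; split; [lra|]; auto|].
      apply (Cm_on_continuous _ _ _ HF'); auto. }
    apply Cm_on_S_intro with
      (g' := (fun x => pw_inv (S (S j)) p F' x + (p - RtoC (INR j)) * pw_inv (S j) p F x)%C).
    + intros x _; apply pw_inv_continuous; auto; lra.
    + intros x _; destruct (Req_dec x 0) as [->|Nx].
      * rewrite !pw_inv_0; replace (0 + (p - RtoC (INR j)) * 0)%C with (RtoC 0) by ring.
        apply (der_pw_inv_0 _ _ _ M); auto; lra.
      * rewrite !pw_inv_neq by auto.
        replace (pw (S (S j)) p x * F' (- / x)%R +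
                   (p - RtoC (INR j)) * (pw (S j) p x * F (- / x)%R))%C with
          ((p - RtoC (INR j)) * pw (S j) p x * F (- / x)%R
             + pw (S (S j)) p x * F' (- / x)%R)%C by ring.
        apply strict_der_der; now apply strict_der_pw_inv.
    + apply Cm_on_plus_scal; apply IH; auto; rewrite !S_INR; lra.
Qed.

(* Differentiating the equation for [(p, F, H)] gives the equation for
   [(p - 2, F', H' + p |x|^p x^(-1) F(-1/x))]. *)
Lemma cocycle_Cm m : forall p F H,
  2 * INR m < Re p -> periodic_on (fun _ => True) F -> cocycle_on (fun _ => True) p F H ->
  (forall x, lim_on (fun _ => True) F x (F x)) ->
  Cm_on (fun x => Rabs x < 1) m H -> Cm_on (fun _ => True) m F.
Proof.
  induction m as [|m IH]; intros p F H Hp HT HF Fc HH.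
  - apply Cm_on_0; auto.
  - rewrite S_INR in Hp; pose proof (pos_INR m) as Hm.
    (* The induction hypothesis serves twice: here on [F] itself, so that the new term
       [pw_inv 1 p F] is of class [C^m], and below on [F']. *)
    assert (HFm : Cm_on (fun _ => True) m F).
    { apply (IH p F H); auto; [lra|now apply Cm_on_pred]. }
    destruct (Cm_on_S_inv _ _ _ HH) as (H' & Hd & HH').
    assert (Hd' : forall x, Rabs x < 1 -> der H x (H' x)).
    { intros x Hx; apply (der_on_open (fun x => Rabs x < 1)); auto; now apply near_Rabs_lt. }
    assert (Hc' : forall x, Rabs x < 1 -> lim_on (fun _ => True) H' x (H' x)).
    { intros x Hx; apply (lim_on_near (fun x => Rabs x < 1) _ H').
      - eapply near_impl; [|exact (near_Rabs_lt x 1 Hx)]; auto.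
      - apply (Cm_on_continuous _ _ _ HH'); auto. }
    assert (ex := cocycle_strict_der p F H H' ltac:(lra) HT HF Fc Hd' Hc').
    set (F' := fun x => proj1_sig (constructive_indefinite_description _ (ex x))).
    assert (Fs : forall x, strict_der F x (F' x)).
    { intros x; exact (proj2_sig (constructive_indefinite_description _ (ex x))). }
    assert (Fd : forall x, der F x (F' x)) by (intros; now apply strict_der_der).
    apply Cm_on_S_intro with (g' := F'); auto.
    apply (IH (p - 2)%C F' (fun x => H' x + p * pw_inv 1 p F x)%C).
    + destruct p; simpl in *; lra.
    + now apply (der_periodic F).
    (* Both sides of the new equation are derivatives of [F] at [x]: the left by choice of [F'], the
       right by differentiating the old equation. *)
    + intros x _ Nx Hx; apply (der_unique F x); auto.
      rewrite pw_inv_neq, cpow_minus_2 by auto.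
      assert (Hs : strict_der H x (H' x)).
      { apply C1_strict_der; auto.
        eapply near_impl; [|exact (near_Rabs_lt x 1 Hx)]; auto. }
      assert (Ps := strict_der_pw_inv 0 p F _ x Nx (Fs (- / x))).
      apply strict_der_der.
      apply (strict_der_ext (fun y => H y + pw_inv 0 p F y)%C F x
        (H' x + ((p - RtoC (INR 0)) * pw 1 p x * F (- / x)%R + pw 2 p x * F' (- / x)%R))%C).
      * eapply near_impl;
          [|apply (near_and _ _ _ (near_nonzero x Nx) (near_Rabs_lt x 1 Hx))].
        intros y [Ny Hy]; rewrite pw_inv_neq, pw_0 by auto; symmetry; auto.
      * rewrite !pw_S, pw_0; unfold Cdiv.
        rewrite <- RtoC_inv, Rinv_mult, RtoC_mult by nra; simpl; ring.
      * intros w Hw; replace w with (w / 2 + w / 2) by field.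
        apply approx_slope_plus; [apply Hs|apply Ps]; lra.
    + intros x; now apply (strict_der_continuous F).
    + apply Cm_on_plus_scal; auto.
      apply (Cm_on_sub (fun _ => True)); auto.
      apply Cm_on_pw_inv; auto; simpl INR; lra.
Qed.

(** * Assembling the statements about [fdag f] *)

Lemma continuous_of_sides F x :
  lim_on (side 1 x) F x (F x) -> lim_on (side (-1) x) F x (F x) ->
  lim_on (fun _ => True) F x (F x).
Proof.
  intros H1 H2 e He; destruct (H1 e He) as (d1 & Hd1 & K1).
  destruct (H2 e He) as (d2 & Hd2 & K2).
  exists (Rmin d1 d2); split; [now apply Rmin_pos|]; intros y _ Hy.
  pose proof (Rmin_l d1 d2); pose proof (Rmin_r d1 d2).
  destruct (Rtotal_order y x) as [L|[->|L]].
  - apply K2; [unfold side; lra|lra].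
  - replace (F x - F x)%C with (RtoC 0) by ring; now rewrite Cmod_0.
  - apply K1; [unfold side; lra|lra].
Qed.

Lemma side_cluster s x d : s <> 0 -> 0 < d -> exists y, side s x y /\ Rabs (y - x) < d.
Proof.
  intros Hs Hd; destruct (Rtotal_order s 0) as [L|[E|L]]; [|lra|].
  - exists (x - d / 2); unfold side; split; [nra|].
    rewrite Rabs_left; lra.
  - exists (x + d / 2); unfold side; split; [nra|].
    rewrite Rabs_pos_eq; lra.
Qed.

Theorem theorem1p1 (k : C) (f : Qc -> C) (h : R -> C) (hp hm : C) :
  (Re k < 0)%R ->
  (forall x : Qc, f (x + 1)%Qc = f x) ->
  (forall x : Qc, x <> 0%Qc ->
     h (QcR x) = (f x - cpow (Rabs (QcR x)) (- k) * f (- / x)%Qc)%C) ->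
  (forall x : R, Icc11 x -> x <> 0%R ->
     filterlim h (within (fun y => Icc11 y /\ y <> 0%R) (locally x))
       (locally (h x))) ->
  filterlim h (at_right 0) (locally hp) ->
  filterlim h (at_left 0) (locally hm) ->
  (* f^dagger is well defined: the limit exists at every irrational *)
  (forall x : R, ~ is_rational x -> exists L : C, rat_lim f x L) /\
  (* f^dagger is continuous at every irrational *)
  (forall x : R, ~ is_rational x -> continuous (fdag f) x) /\
  (* one-sided limits at rationals a/q, q = denominator in lowest terms *)
  (forall x : Qc,
     let q := IZR (Z.pos (Qden (this x))) in
     filterlim (fdag f) (at_right (QcR x))
       (locally (f x + cpow q k * (hp - f 0%Qc))%C) /\
     filterlim (fdag f) (at_left (QcR x))
       (locally (f x + cpow q k * (hm - f 0%Qc))%C)) /\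
  ((forall x : R, continuous (fdag f) x) <-> (hp = f 0%Qc /\ hm = f 0%Qc)) /\
  (hp = f 0%Qc -> hm = f 0%Qc ->
   forall m : nat, (INR m < Rabs (Re k) / 2)%R ->
     Cm_on Icc11 m (fun x => if Req_EM_T x 0 then f 0%Qc else h x) ->
     Cm_on (fun _ => True) m (fdag f)).
Proof.
  intros Hk Hper Hh Hcont Hr Hl.
  set (p := (- k)%C); assert (Hp : 0 < Re p) by (destruct k; simpl in *; lra).
  assert (Ek : (- p)%C = k) by (unfold p; ring).
  set (F := fdag f).
  assert (F0 : F 0 = f 0%Qc) by (unfold F; rewrite <- QcR_0; apply fdag_Qc).
  assert (HT : periodic_on is_rational F).
  { apply periodic_on_step; [intros; now apply is_rational_plus_IZR|].
    intros x [q <-]; rewrite <- QcR_plus_1; unfold F; now rewrite !fdag_Qc. }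
  assert (HF : cocycle_on is_rational p F h).
  { intros x [q <-] Nq _.
    assert (Nq' : q <> 0%Qc) by (intros ->; apply Nq, QcR_0).
    rewrite Hh, <- QcR_opp_inv by auto; unfold F; rewrite !fdag_Qc; fold p; ring. }
  assert (hc : forall x, x <> 0 -> Rabs x < 1 -> lim_on (fun _ => True) h x (h x)).
  { intros x Nx Hx.
    apply (lim_on_near (fun y => Icc11 y /\ y <> 0) (fun _ => True) h h).
    - eapply near_impl;
        [|apply (near_and _ _ _ (near_nonzero x Nx) (near_Rabs_lt x 1 Hx))].
      intros y [Ny Hy] _; apply Rabs_def2 in Hy; repeat split; auto; lra.
    - apply filterlim_lim_on, Hcont; auto; apply Rabs_def2 in Hx; split; lra. }
  assert (hr : lim_on (side 1 0) h 0 hp).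
  { apply (lim_on_sub (fun y => 0 < y)); [unfold side; intros; lra|].
    apply filterlim_lim_on; exact Hr. }
  assert (hl : lim_on (side (-1) 0) h 0 hm).
  { apply (lim_on_sub (fun y => y < 0)); [unfold side; intros; lra|].
    apply filterlim_lim_on; exact Hl. }
  assert (hb : exists H, forall y, - (1/2) <= y <= 1/2 -> y <> 0 -> Cmod (h y) <= H).
  { apply (locally_bounded_bounded (fun y => y <> 0)); intros x Hx.
    destruct (Req_dec x 0) as [->|Nx].
    (* At [0] local boundedness comes from the two one-sided limits, which may differ. *)
    - exists (Rmax (Cmod hp + 1) (Cmod hm + 1)).
      eapply near_impl;
        [|apply (near_and _ _ _ (lim_on_bounded _ _ _ _ hr) (lim_on_bounded _ _ _ _ hl))].
      intros y [K1 K2] Ny; destruct (Rtotal_order y 0) as [L|[E|L]]; [|tauto|].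
      + eapply Rle_trans; [|apply Rmax_r]; apply K2; unfold side; lra.
      + eapply Rle_trans; [|apply Rmax_l]; apply K1; unfold side; lra.
    - exists (Cmod (h x) + 1).
      eapply near_impl; [|apply (lim_on_bounded _ _ _ _ (hc x Nx ltac:(apply Rabs_def1; lra)))].
      auto. }
  destruct (cocycle_bounded_rational p F h Hp HT HF hb) as (M & HM & FM).
  assert (irr : forall x, ~ is_rational x -> exists L, rat_lim f x L).
  { intros x Nx; destruct (cocycle_limit_irrational p F h M Hp HT HF hc HM FM x Nx) as [L HL].
    exists L; now apply rat_lim_fdag. }
  assert (HR : rational_closure_fun F).
  { intros x Nx; apply rat_lim_fdag; auto.
    destruct (irr x Nx) as [L HL]; now apply fdag_irrational with L. }
  assert (HT' := closure_periodic F HR HT).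
  assert (HF' := closure_cocycle p F h HR HF hc).
  assert (FM' := closure_bounded F M HR FM).
  assert (sides : forall s h0, lim_on (side s 0) h 0 h0 -> forall x : Qc,
            lim_on (side s (QcR x)) F (QcR x)
              (f x + cpow (IZR (Z.pos (Qden (this x)))) k * (h0 - f 0%Qc))%C).
  { intros s h0 H0 x; destruct (QcR_frac x) as [E G].
    pose proof (cocycle_one_sided_limit p F h s h0 M Hp HT' HF' hc H0 FM' _ _
      (Pos2Z.is_pos _) G) as K.
    rewrite <- E, Ek, F0 in K; unfold F in K at 2; now rewrite fdag_Qc in K. }
  assert (cont_irr : forall x, ~ is_rational x -> lim_on (fun _ => True) F x (F x)).
  { intros; now apply closure_continuous_irrational. }
  assert (cont : hp = f 0%Qc -> hm = f 0%Qc -> forall x, lim_on (fun _ => True) F x (F x)).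
  { intros Ep Em x; destruct (classic (is_rational x)) as [[q <-]|Nx]; [|auto].
    assert (Eq : F (QcR q) = f q) by apply fdag_Qc.
    (* When both limits of [h] equal [f 0], the jump term vanishes at every rational. *)
    apply continuous_of_sides; rewrite Eq.
    - pose proof (sides 1 hp hr q) as K; rewrite Ep in K.
      match type of K with lim_on _ _ _ ?l => replace (f q) with l by ring end; auto.
    - pose proof (sides (-1) hm hl q) as K; rewrite Em in K.
      match type of K with lim_on _ _ _ ?l => replace (f q) with l by ring end; auto. }
  split; [exact irr|]; split; [|split; [|split]].
  - intros x Nx; apply continuous_lim_on; auto.
  - intros x q; split; apply filterlim_lim_on.
    + apply (lim_on_sub (side 1 (QcR x))); [unfold side; intros; lra|now apply sides].
    + apply (lim_on_sub (side (-1) (QcR x))); [unfold side; intros; lra|now apply sides].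
  - split.
    + intros Hc.
      (* It suffices to look at [0 = 0/1]: the weight is 1 there, so the one-sided limit of [F] is
         [h0], and continuity equates it with [F 0]. *)
      assert (K : forall s h0, s <> 0 -> lim_on (side s 0) h 0 h0 -> h0 = f 0%Qc).
      { intros s h0 Hs H0; pose proof (sides s h0 H0 0%Qc) as K; rewrite QcR_0 in K.
        assert (C0 : lim_on (side s 0) F 0 (F 0)).
        { apply (lim_on_sub (fun _ => True)); auto; now apply continuous_lim_on. }
        pose proof (lim_on_unique _ _ _ _ _ (fun d => side_cluster s 0 d Hs) K C0) as E.
        rewrite F0 in E; simpl in E.
        rewrite cpow_1_l in E.
        transitivity (f 0%Qc + 1 * (h0 - f 0%Qc))%C; [ring|exact E]. }
      split; [apply (K 1)|apply (K (-1))]; auto; lra.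
    + intros [Ep Em] x; apply continuous_lim_on; apply cont; auto.
  - intros Ep Em m Hm HH.
    apply (cocycle_Cm m p F (fun x => if Req_EM_T x 0 then f 0%Qc else h x)); auto.
    + rewrite Rabs_left in Hm by auto; destruct k; simpl in *; lra.
    + intros x Dx Nx Hx; destruct (Req_EM_T x 0); [tauto|auto].
    (* Restriction to the open interval, where derivatives within the set are ordinary two-sided
       ones. *)
    + apply (Cm_on_sub Icc11); auto.
      intros x Hx; apply Rabs_def2 in Hx; split; lra.
Qed.
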